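(* Let $s\in(0,1)$, $N>2s$, let $\Omega\subset\mathbb{R}^N$ be a bounded domain with Lipschitz boundary, and let $k\ge2$. If there is a $y\in E_k$ such that $|y^+|_2\ne|y^-|_2$, then there is a neighborhood $U\subset Q_k$ of $(\lambda_k,\lambda_k)$ such that every point $(a,b)\in U\setminus\{(\lambda_k,\lambda_k)\}$ with $a+b=2\lambda_k$ is in $\mathrm{II}_k$.
   Context: Let $X^s(\Omega)=\{u\in L^2(\mathbb{R}^N): \|u\|<\infty,\ u=0\text{ a.e. in }\mathbb{R}^N\setminus\Omega\}$, a Hilbert space with inner product $(u,v)=\int_{\mathbb{R}^{2N}}\frac{(u(x)-u(y))(v(x)-v(y))}{|x-y|^{N+2s}}\,dx\,dy$ and norm $\|u\|=(u,u)^{1/2}$. Write $u^\pm=\max\{\pm u,0\}$, and let $|\cdot|_2$ be the norm of $L^2(\Omega)$. Let $0<\lambda_1<\lambda_2<\cdots$ be the distinct eigenvalues of $(-\Delta)^s$ in $\Omega$, i.e. the $\lambda$ for which there is $u\in X^s(\Omega)\setminus\{0\}$ with $(u,v)=\lambda\int_\Omega uv\,dx$ for all $v\in X^s(\Omega)$; let $E_k$ be the (finite dimensional) eigenspace of $\lambda_k$, $N_k=\bigoplus_{j=1}^kE_j$, $M_k=N_k^\perp\cap X^s(\Omega)$ (orthogonality in $X^s(\Omega)$ and in $L^2(\Omega)$ give the same space), and $Q_k=(\lambda_{k-1},\lambda_{k+1})^2$. Let $I(u,a,b)=\frac12\|u\|^2-\frac12\int_\Omega\left[b(u^+)^2+a(u^-)^2\right]dx$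 for $u\in X^s(\Omega)$. For $B\subset X^s(\Omega)$ put $\widetilde B=\{u\in B:\|u\|=1\}$. For $(a,b)\in Q_k$ set $$n_{k-1}(a,b)=\inf_{w\in\widetilde M_{k-1}}\ \sup_{v\in N_{k-1}}I(v+w,a,b),\qquad m_k(a,b)=\sup_{v\in\widetilde N_k}\ \inf_{w\in M_k}I(v+w,a,b),$$ and for $a\in(\lambda_{k-1},\lambda_{k+1})$ set $$\nu_{k-1}(a)=\sup\{b\in(\lambda_{k-1},\lambda_{k+1}):n_{k-1}(a,b)\ge0\},\qquad\mu_k(a)=\inf\{b\in(\lambda_{k-1},\lambda_{k+1}):m_k(a,b)\le0\}.$$ Finally, $\mathrm{II}_k=\{(a,b)\in Q_k:\nu_{k-1}(a)<b<\mu_k(a)\}$. *)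

(* Defs.v *)
From HB Require Import structures.
From mathcomp Require Import all_boot all_order all_algebra.
From mathcomp Require Import all_classical all_reals all_analysis.

Set Implicit Arguments.
Unset Strict Implicit.
Unset Printing Implicit Defensive.
Import Order.TTheory GRing.Theory Num.Theory.
Import numFieldNormedType.Exports.

Local Open Scope classical_set_scope.
Local Open Scope ring_scope.

(* R^N is 'rV[R]_N.  Its sigma-algebra is the product (= Borel) one, generated
   by the coordinates, as the library does for n.-tuple T. *)
Definition measure_rV_display : measure_display.
Proof. exact: default_measure_display. Qed.

Section measurable_rV.
Context {R : realType}.
Variable n : nat.

Let coords : 'I_n -> 'rV[R]_n -> R := fun i x => x ord0 i.

Let rV_set0 : g_sigma_preimage coords set0.
Proof. exact: sigma_algebra0. Qed.

Let rV_setC A : g_sigma_preimage coords A -> g_sigma_preimage coords (~` A).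
Proof. exact: sigma_algebraC. Qed.

Let rV_bigcup (F : (set 'rV[R]_n)^nat) :
  (forall i, g_sigma_preimage coords (F i)) ->
  g_sigma_preimage coords (\bigcup_i (F i)).
Proof. exact: sigma_algebra_bigcup. Qed.

HB.instance Definition _ := @isMeasurable.Build measure_rV_display
  'rV[R]_n (g_sigma_preimage coords) rV_set0 rV_setC rV_bigcup.

End measurable_rV.

Lemma measurable_coord (R : realType) n (i : 'I_n) :
  measurable_fun [set: 'rV[R]_n] (fun x => x ord0 i).
Proof.
move=> _ Y mY; rewrite setTI; apply: sub_sigma_algebra => /=.
rewrite -bigcup_seq/=; exists i => /=; first by rewrite mem_index_enum.
by exists Y => //; rewrite setTI.
Qed.

Lemma measurable_fun_rVP (R : realType) d (T : measurableType d) n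
    (f : T -> 'rV[R]_n) :
  (forall i, measurable_fun [set: T] (fun x => f x ord0 i)) ->
  measurable_fun [set: T] f.
Proof.
move=> mf; apply: (@measurability _ _ _ _ _ _ (\big[setU/set0]_(i < n)
  preimage_set_system setT (fun x : 'rV[R]_n => x ord0 i) measurable)) => //.
move=> _ [B + <-]; rewrite -bigcup_seq => -[i _ [A mA <-]].
by rewrite setTI; have := mf i measurableT A mA; rewrite !setTI.
Qed.

Section lebesgue_rV.
Context {R : realType}.

Definition consrV n (p : measurableTypeR R * 'rV[R]_n) : 'rV[R]_n.+1 :=
  \row_i if unlift ord0 i is Some j then p.2 ord0 j else p.1 : R.

Lemma consrV0 n p : @consrV n p ord0 ord0 = p.1.
Proof. by rewrite mxE unlift_none. Qed.

Lemma consrVS n p (i : 'I_n) : @consrV n p ord0 (lift ord0 i) = p.2 ord0 i.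
Proof. by rewrite mxE liftK. Qed.

Lemma measurable_consrV n : measurable_fun setT (@consrV n).
Proof.
apply: measurable_fun_rVP => i; case: (unliftP ord0 i) => [j ->|->].
  under eq_fun do rewrite consrVS.
  exact: measurableT_comp (measurable_coord j) measurable_snd.
under eq_fun do rewrite consrV0.
exact: measurable_fst.
Qed.

Section step.
Variables (n : nat) (m : {sigma_finite_measure set 'rV[R]_n -> \bar R}).

Definition lebesgue_step : set 'rV[R]_n.+1 -> \bar R :=
  pushforward ((@lebesgue_measure R) \x m)%E (@consrV n).

Let step0 : (lebesgue_step set0 = 0)%E.
Proof. by rewrite /lebesgue_step /pushforward preimage_set0 measure0. Qed.

Let step_ge0 A : (0 <= lebesgue_step A)%E.
Proof. by rewrite /lebesgue_step /pushforward; apply: measure_ge0. Qed.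

Let step_sigma_additive : semi_sigma_additive lebesgue_step.
Proof.
exact: (@measure_semi_sigma_additive _ _ _
  (measure_function_pushforward__canonical__measure_function_Measure
     ((@lebesgue_measure R) \x m)%E (@measurable_consrV n))).
Qed.

HB.instance Definition _ := isMeasure.Build _ _ _ lebesgue_step
  step0 step_ge0 step_sigma_additive.

Let step_sigma_finite : sigma_finite setT lebesgue_step.
Proof.
have [F FT Foo] : sigma_finite setT ((@lebesgue_measure R) \x m)%E.
  have /sigma_finiteP[F [TF ndF Foo]] := sigma_finiteT (@lebesgue_measure R).
  have /sigma_finiteP[G [TG ndG Goo]] := sigma_finiteT m.
  exists (fun k => F k `*` G k).
    rewrite -setXTT TF TG predeqE => -[x y]; split.
      move=> [/= [i _ Fx] [j _ Gy]]; exists (maxn i j) => //; split.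
        by move: x Fx; exact/subsetPset/ndF/leq_maxl.
      by move: y Gy; exact/subsetPset/ndG/leq_maxr.
    by move=> [i _ []/= ? ?]; split; exists i.
  move=> k; have [? ?] := Foo k; have [? ?] := Goo k.
  split; first exact: measurableX.
  by rewrite product_measure1E// lte_mul_pinfty// ge0_fin_numE.
pose g (x : 'rV[R]_n.+1) : measurableTypeR R * 'rV[R]_n :=
  (x ord0 ord0, \row_i x ord0 (lift ord0 i)).
have mg : measurable_fun setT g.
  apply/measurable_fun_pairP; split; first exact: (measurable_coord ord0).
  apply: measurable_fun_rVP => i; rewrite /g /=.
  by under eq_fun do rewrite mxE; exact: measurable_coord.
have consK p : g (consrV p) = p.
  case: p => x v; rewrite /g consrV0; congr pair.
  by apply/rowP => i; rewrite mxE consrVS.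
exists (fun k => g @^-1` F k).
  by rewrite -preimage_bigcup -FT preimage_setT.
move=> k; have [mF Fk] := Foo k; split.
  by rewrite -[X in measurable X]setTI; exact: mg.
rewrite /lebesgue_step /pushforward -comp_preimage.
by rewrite (_ : g \o _ = id) ?preimage_id//; apply/funext => p /=.
Qed.

HB.instance Definition _ := Measure_isSigmaFinite.Build _ _ _ lebesgue_step
  step_sigma_finite.

End step.

Fixpoint lebesgue_rV n : {sigma_finite_measure set 'rV[R]_n -> \bar R} :=
  match n with
  | 0 => \d_(0 : 'rV[R]_0)
  | n.+1 => lebesgue_step (lebesgue_rV n)
  end.

Lemma lebesgue_rV_box n (A : 'I_n -> set (measurableTypeR R)) :
  (forall i, measurable (A i)) ->
  lebesgue_rV n [set x | forall i, A i (x ord0 i)] =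
    (\prod_(i < n) lebesgue_measure (A i))%E.
Proof.
elim: n A => [|n IH] A mA.
  by rewrite big_ord0 /= diracE mem_set// => -[].
rewrite big_ord_recl -(IH (fun i => A (lift ord0 i)))//=.
have mB : measurable [set x : 'rV[R]_n | forall i, A (lift ord0 i) (x ord0 i)].
  rewrite (_ : mkset _ = \bigcap_(i in [set: 'I_n])
      (fun x : 'rV[R]_n => x ord0 i) @^-1` A (lift ord0 i)).
    apply: fin_bigcap_measurable => // i _.
    rewrite -[X in measurable X]setTI.
    exact: (measurable_coord i measurableT (mA (lift ord0 i))).
  by apply/seteqP; split => x /= H i; [move=> _; exact: H|exact: (H i)].
rewrite /lebesgue_step /pushforward -product_measure1E//.
congr product_measure1; apply/seteqP; split => -[x v] /= H.
  split; first by have := H ord0; rewrite consrV0.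
  by move=> i; have := H (lift ord0 i); rewrite consrVS.
move=> i; case: (unliftP ord0 i) => [j ->|->]; last by rewrite consrV0; case: H.
by rewrite consrVS; case: H => _; exact.
Qed.

End lebesgue_rV.

Section setting.
Context {R : realType} {N : nat}.
Implicit Types (s l a b : R) (Omega : set 'rV[R]_N) (u v w : 'rV[R]_N -> R).

Local Notation mu := (@lebesgue_rV R N).

Definition dotp (x y : 'rV[R]_N) : R := \sum_(i < N) x ord0 i * y ord0 i.

(* The library norm `|x| on 'rV[R]_N is the sup norm; this is the Euclidean
   one. *)
Definition enorm (x : 'rV[R]_N) : R := Num.sqrt (dotp x x).

(* Near each boundary point x, and for a suitable unit vector e, Omega is the
   region strictly above the graph of a Lipschitz function gamma defined on the
   hyperplane e^\bot; z - (z.e) e is the projection of z on that hyperplane. *)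
Definition lipschitz_boundary Omega : Prop :=
  forall x, closure Omega x -> ~ interior Omega x ->
  exists (e : 'rV[R]_N) (gamma : 'rV[R]_N -> R),
    [/\ dotp e e = 1,
        [lipschitz gamma z | z in [set z | dotp z e = 0]] &
        \forall z \near x,
          Omega z <-> gamma (z - dotp z e *: e) < dotp z e].

Definition bounded_lipschitz_domain Omega : Prop :=
  [/\ open Omega, connected Omega, Omega !=set0, bounded_set Omega &
      lipschitz_boundary Omega].

(* At x = y the integrand is 0 * (0 `^ _)^-1 = 0, which is harmless: the
   diagonal is negligible in R^N x R^N. *)
Definition gagliardo_integrand s u v (z : 'rV[R]_N * 'rV[R]_N) : R :=
  (u z.1 - u z.2) * (v z.1 - v z.2) / enorm (z.1 - z.2) `^ (N%:R + 2 * s).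

Definition ip s u v : R :=
  \int[(mu \x mu)%E]_z gagliardo_integrand s u v z.

Definition Xnorm s u : R := Num.sqrt (ip s u u).

(* Elements of X^s(Omega) are (Borel) functions rather than classes modulo
   almost everywhere equality; Xs, and everything below, is invariant under
   almost everywhere modification. *)
Definition Xs s Omega : set ('rV[R]_N -> R) :=
  [set u | [/\ u \in Lfun mu 2%:E,
     (\int[(mu \x mu)%E]_z (gagliardo_integrand s u u z)%:E < +oo)%E &
     {ae mu, forall x, ~ Omega x -> u x = 0}]].

Definition L2norm Omega u : R := Num.sqrt (\int[mu]_(x in Omega) u x ^+ 2).

Definition eigenspace s Omega l : set ('rV[R]_N -> R) :=
  [set u | Xs s Omega u /\
     forall v, Xs s Omega v ->
       ip s u v = l * \int[mu]_(x in Omega) (u x * v x)].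

Definition is_eigenvalue s Omega l : Prop :=
  exists u, eigenspace s Omega l u /\ ~ {ae mu, forall x, u x = 0}.

(* lam 1 < lam 2 < ... is the list of distinct eigenvalues; lam 0 is not
   used. *)
Definition distinct_eigenvalues s Omega (lam : nat -> R) : Prop :=
  [/\ 0 < lam 1%N,
      forall j, (1 <= j)%N -> lam j < lam j.+1 &
      forall l, is_eigenvalue s Omega l <-> exists2 j, (1 <= j)%N & l = lam j].

Section spaces.
Variables (s : R) (Omega : set 'rV[R]_N) (lam : nat -> R).

Definition eigsp k : set ('rV[R]_N -> R) := eigenspace s Omega (lam k).

Definition Nsp k : set ('rV[R]_N -> R) :=
  [set u | exists v : nat -> 'rV[R]_N -> R,
     (forall j, (1 <= j <= k)%N -> eigsp j (v j)) /\
     u = \sum_(1 <= j < k.+1) v j].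

Definition Msp k : set ('rV[R]_N -> R) :=
  [set u | Xs s Omega u /\ forall v, Nsp k v -> ip s u v = 0].

Definition usphere (B : set ('rV[R]_N -> R)) : set ('rV[R]_N -> R) :=
  [set u | B u /\ Xnorm s u = 1].

Definition energy u a b : R :=
  2^-1 * Xnorm s u ^+ 2 -
  2^-1 * \int[mu]_(x in Omega) (b * u^\+ x ^+ 2 + a * u^\- x ^+ 2).

Definition Qsq k : set (R * R) :=
  [set ab | lam k.-1 < ab.1 < lam k.+1 /\ lam k.-1 < ab.2 < lam k.+1].

(* n_pred k is n_{k-1} and nu_pred k is nu_{k-1}. *)
Definition n_pred k a b : \bar R :=
  ereal_inf [set ereal_sup [set (energy (v \+ w) a b)%:E | v in Nsp k.-1]
            | w in usphere (Msp k.-1)].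

Definition m_ k a b : \bar R :=
  ereal_sup [set ereal_inf [set (energy (v \+ w) a b)%:E | w in Msp k]
            | v in usphere (Nsp k)].

Definition nu_pred k a : \bar R :=
  ereal_sup [set b%:E | b in
    [set b | lam k.-1 < b < lam k.+1 /\ (0 <= n_pred k a b)%E]].

Definition mu_ k a : \bar R :=
  ereal_inf [set b%:E | b in
    [set b | lam k.-1 < b < lam k.+1 /\ (m_ k a b <= 0)%E]].

Definition region_II k : set (R * R) :=
  [set ab | Qsq k ab /\ (nu_pred k ab.1 < ab.2%:E < mu_ k ab.1)%E].

End spaces.
End setting.

(* Main.v *)
(* On the line a = l - t, b = l + t through (l, l), with l = lambda_k, the energy
   is I(u) = (||u||^2 - l |u|^2 - t S(u)) / 2, where S(u) = |u^+|^2 - |u^-|^2 is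
   odd and |S(u + w) - S(w)| <= (1 + K) |u|^2 + |w|^2 / K for every K > 0.  An
   eigenfunction w = +-y with t S(w) > 0 makes sup_{v in N_{k-1}} I(v + w)
   negative: the quadratic part is at most - (l - lambda_{k-1}) |v|^2, which
   absorbs the perturbation of t S for small t.  The opposite sign of w makes
   inf_{z in M_k} I(w + z) positive, because ||z||^2 >= lambda_{k+1} |z|^2 on M_k.

   That last inequality holds because the infimum of ||z||^2 / |z|^2 on M_k is
   attained, at an eigenfunction orthogonal to N_k.  Attainment needs X^s to be
   complete (Fatou along a fast Cauchy sequence) and a quantitative form of the
   compactness of X^s in L^2: on a cube q of side h,
     int_q u^2 = (iint_{q x q} (u(x) - u(y))^2) / (2 |q|) + (int_q u)^2 / |q|,
   so that |u|^2 <= C h^{2s} ||u||^2 plus finitely many squares of functionals. *)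

Require Import Defs.
From mathcomp Require Import all_boot all_order all_algebra.
From mathcomp Require Import all_classical all_reals all_analysis.
From mathcomp Require Import measurable_realfun lra ring.
Import Order.TTheory GRing.Theory Num.Theory.
Import numFieldNormedType.Exports.
Local Open Scope classical_set_scope.
Local Open Scope ring_scope.
Set Implicit Arguments.
Unset Strict Implicit.
Unset Printing Implicit Defensive.

(** * Spectral theory of a pair of quadratic forms *)

Lemma geo_gt0 (R : realType) n : 0 < (16%:R^-1 : R) ^+ n.
Proof. by rewrite exprn_gt0. Qed.

Lemma geo_le (R : realType) n m :
  (n <= m)%N -> (16%:R^-1 : R) ^+ m <= 16%:R^-1 ^+ n.
Proof. by move=> nm; rewrite ler_wiXn2l//; lra. Qed.

Lemma le_geo_le0 (R : realType) (x K : R) :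
  (forall n, x <= K * 16%:R^-1 ^+ n) -> x <= 0.
Proof.
move=> xK; have : (fun n => K * (16%:R^-1 : R) ^+ n) @ \oo --> K * 0.
  by apply: cvgMr; apply: cvg_expr; rewrite ger0_norm; lra.
rewrite mulr0 => cK; rewrite -(cvg_lim _ cK)//.
by apply: limr_ge; [apply/cvg_ex; exists 0|near=> n; exact: xK].
Unshelve. all: by end_near.
Qed.

(** The cube [[-K, K]^I] is compact by Tychonoff's theorem, so the sequence has a cluster point [c].
    The distance is squared because functionals enter later as sums of squares. *)
Lemma bounded_sequences_cluster (R : realType) (I : finType)
    (x : nat -> I -> R) (K : R) :
  (forall n i, `|x n i| <= K) ->
  exists c : I -> R, forall e n, 0 < e ->
    exists2 m, (n <= m)%N & forall i, (x m i - c i) ^+ 2 <= e.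
Proof.
move=> xK; pose D : set (prod_topology (fun _ : I => R)) :=
  [set f | forall i, [set` `[(- K), K]%R] (f i)].
have cD : compact D.
  exact: (@tychonoff I (fun=> R) (fun=> [set` `[(- K), K]%R])
    (fun=> @segment_compact R (- K) K)).
have xD : (x @ \oo) D.
  by apply: (@filterE _ \oo) => n i /=; rewrite in_itv/= -ler_norml.
have [c [_ xc]] := cD _ _ xD; exists c => e n e0.
have sqe : 0 < Num.sqrt e by rewrite sqrtr_gt0.
have nc : nbhs c [set f : prod_topology (fun _ : I => R) |
    forall i, `|c i - f i| <= Num.sqrt e].
  apply: (@filter_forall _ _ (fun i (f : prod_topology _) =>
    `|c i - f i| <= Num.sqrt e) (nbhs c)) => i.
  apply: (@proj_continuous I (fun=> R) i c [set r | `|c i - r| <= Num.sqrt e]).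
  by apply/nbhs_normP; exists (Num.sqrt e) => // r /= /ltW.
have : (x @ \oo) [set x m | m in [set m | (n <= m)%N]].
  by apply: filterS (nbhs_infty_ge n) => m nm; exists m.
move=> /xc/(_ nc)[_ [[m /= nm <-] xm]]; exists m => // i.
rewrite -[leRHS](sqr_sqrtr (ltW e0)) -real_normK ?num_real// distrC.
by rewrite lerXn2r ?nnegrE// sqrtr_ge0.
Qed.

Section forms.
Variables (R : realType) (V : lmodType R) (X : set V).

(** Linearity is asked on [X] only: integrals are additive on integrable functions, while [ip] is
    defined on all functions. *)
Definition linear_on (f : V -> R) :=
  forall c u v, X u -> X v -> f (c *: u + v) = c * f u + f v.

Definition is_subspace (Y : set V) :=
  Y 0 /\ forall c u v, Y u -> Y v -> Y (c *: u + v).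

Hypothesis X_sub : is_subspace X.

Lemma subspaceZ (Y : set V) c u : is_subspace Y -> Y u -> Y (c *: u).
Proof. by move=> [Y0 YZ] Yu; rewrite -[_ *: _]addr0; exact: YZ. Qed.

Lemma subspaceD (Y : set V) u v : is_subspace Y -> Y u -> Y v -> Y (u + v).
Proof. by move=> [_ YZ] Yu Yv; rewrite -[u]scale1r; exact: YZ. Qed.

Lemma subspaceB (Y : set V) u v : is_subspace Y -> Y u -> Y v -> Y (u - v).
Proof. by move=> [_ YZ] Yu Yv; rewrite addrC -scaleN1r; exact: YZ. Qed.

Lemma linear_onB f u v : linear_on f -> X u -> X v -> f (u - v) = f u - f v.
Proof. by move=> lf Xu Xv; rewrite addrC -scaleN1r lf// mulN1r addrC. Qed.

Lemma linear_onZ f c u : linear_on f -> X u -> f (c *: u) = c * f u.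
Proof.
move=> lf Xu; have X0 := X_sub.1.
have f0 : f 0 = 0.
  by have := lf 1 0 0 X0 X0; rewrite scaler0 addr0; lra.
by rewrite -[in LHS](addr0 (c *: u)) lf// f0 addr0.
Qed.

Lemma linear_onD f u v : linear_on f -> X u -> X v -> f (u + v) = f u + f v.
Proof. by move=> lf Xu Xv; rewrite -[u in LHS]scale1r lf// mul1r. Qed.

Record sym_form (q : V -> V -> R) : Prop := SymForm {
  formC : forall u v, q u v = q v u;
  form_lin : forall w, X w -> linear_on (q^~ w) }.

Section sym_form_theory.
Variable q : V -> V -> R.
Hypothesis qf : sym_form q.

Lemma formDl u v w : X u -> X v -> X w -> q (u + v) w = q u w + q v w.
Proof. by move=> Xu Xv Xw; exact: (linear_onD (form_lin qf Xw)). Qed.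

Lemma formBl u v w : X u -> X v -> X w -> q (u - v) w = q u w - q v w.
Proof. by move=> Xu Xv Xw; exact: (linear_onB (form_lin qf Xw)). Qed.

Lemma formZl c u w : X u -> X w -> q (c *: u) w = c * q u w.
Proof. by move=> Xu Xw; exact: (linear_onZ c (form_lin qf Xw)). Qed.

Lemma form0l w : X w -> q 0 w = 0.
Proof.
by move=> Xw; rewrite -(scale0r 0) formZl ?mul0r//; exact: X_sub.1.
Qed.

Lemma formDD u v : X u -> X v ->
  q (u + v) (u + v) = q u u + 2 * q u v + q v v.
Proof.
move=> Xu Xv; have Xuv : X (u + v) by exact: subspaceD.
rewrite formDl// (formC qf u) (formC qf v) !formDl// (formC qf v u).
by ring.
Qed.

Lemma formZZ c u : X u -> q (c *: u) (c *: u) = c ^+ 2 * q u u.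
Proof.
move=> Xu; have Xcu : X (c *: u) by exact: subspaceZ.
by rewrite formZl// (formC qf u) formZl// mulrA expr2.
Qed.

Lemma formBB u v : X u -> X v ->
  q (u - v) (u - v) = q u u - 2 * q u v + q v v.
Proof.
move=> Xu Xv; have XNv : X (-1 *: v) by exact: subspaceZ.
rewrite -scaleN1r formDD// formZZ// (formC qf u) formZl// (formC qf v).
by ring.
Qed.

(* [d <= q (u - t w) (u - t w)] for all [t] bounds a discriminant. *)
Lemma near_minimum_orthogonal u w d e : X u -> X w -> 0 <= q w w ->
  (forall t, d <= q (u - t *: w) (u - t *: w)) -> q u u <= d + e ->
  q u w ^+ 2 <= e * q w w.
Proof.
move=> Xu Xw qw0 dle que.
have quad t : 0 <= e - 2 * t * q u w + t ^+ 2 * q w w.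
  have Xtw : X (t *: w) by exact: subspaceZ.
  have := dle t; rewrite formBB// formZZ// (formC qf u) formZl// (formC qf w).
  by lra.
have [qw|qw] := ltP 0 (q w w).
  rewrite -subr_ge0; have := mulr_ge0 qw0 (quad (q u w / q w w)).
  by congr (0 <= _); field; rewrite gt_eqF.
have {}qw0 : q w w = 0 by apply/eqP; rewrite eq_le qw.
rewrite qw0 mulr0; have [->|quw] := eqVneq (q u w) 0; first by rewrite expr0n.
(* For [q w w = 0] the bound is affine in [t]; at this [t] it would equal [e - (e + 1) = -1]. *)
have := quad ((e + 1) / (2 * q u w)); rewrite qw0 mulr0 addr0.
have -> : 2 * ((e + 1) / (2 * q u w)) * q u w = e + 1 by field.
by lra.
Qed.

(** The previous lemma with [d = 0] and [e = q u u]. Positivity is taken on a subspace [Y] because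
    the inequality is applied to [A - L B], known to be nonnegative on an annihilator. *)
Lemma form_cauchy_schwarz (Y : set V) u w : Y `<=` X -> is_subspace Y ->
  (forall v, Y v -> 0 <= q v v) -> Y u -> Y w ->
  q u w ^+ 2 <= q u u * q w w.
Proof.
move=> YX sY q0 Yu Yw.
apply: (@near_minimum_orthogonal _ _ 0); rewrite ?add0r//; try exact: YX.
  exact: q0.
move=> t; apply: q0; apply: subspaceB => //; exact: subspaceZ.
Qed.

Lemma form_parallelogram u v : X u -> X v ->
  q (u - v) (u - v) = 2 * q u u + 2 * q v v - q (u + v) (u + v).
Proof. by move=> Xu Xv; rewrite formBB// formDD//; ring. Qed.

Lemma form_continuous v : (forall u, X u -> 0 <= q u u) -> X v ->
  forall d, X d -> q d v ^+ 2 <= q v v * q d d.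
Proof.
move=> q0 Xv d Xd; rewrite mulrC.
by apply: (@form_cauchy_schwarz X).
Qed.

End sym_form_theory.

(** * Eigenspaces and minimisers for a complete pair of nonnegative forms *)

Variables A B : V -> V -> R.
Hypotheses (Af : sym_form A) (Bf : sym_form B).
Hypothesis A_ge0 : forall u, X u -> 0 <= A u u.
Hypothesis B_ge0 : forall u, X u -> 0 <= B u u.

(* The factor 2 allows the limit to be taken in [A] and in [B] separately. *)
Hypothesis AB_complete : forall u : nat -> V, (forall n, X (u n)) ->
  (forall n m, (n <= m)%N -> A (u m - u n) (u m - u n) +
     B (u m - u n) (u m - u n) <= 16%:R^-1 ^+ n) ->
  exists2 p, X p & forall n, A (u n - p) (u n - p) +
     B (u n - p) (u n - p) <= 2 * 16%:R^-1 ^+ n.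

(** Continuity on [X] for the norm with square [A d d + B d d]. *)
Definition bounded_on (f : V -> R) :=
  exists K, forall d, X d -> f d ^+ 2 <= K * (A d d + B d d).

Lemma bounded_onA v : X v -> bounded_on (A^~ v).
Proof.
move=> Xv; exists (A v v) => d Xd; apply: le_trans (form_continuous Af _ _ _) _ => //.
by rewrite ler_wpM2l ?A_ge0// lerDl B_ge0.
Qed.

Lemma bounded_onB v : X v -> bounded_on (B^~ v).
Proof.
move=> Xv; exists (B v v) => d Xd; apply: le_trans (form_continuous Bf _ _ _) _ => //.
by rewrite ler_wpM2l ?B_ge0// lerDr A_ge0.
Qed.

Lemma sym_formBZ c : sym_form (fun u v => A u v - c * B u v).
Proof.
split=> [u v|w Xw t u v Xu Xv]; first by rewrite (formC Af) (formC Bf).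
by rewrite !(form_lin Af)// !(form_lin Bf)//; ring.
Qed.

Lemma bounded_onBZ c v : X v -> bounded_on (fun u => A u v - c * B u v).
Proof.
move=> Xv; have [K HK] := bounded_onA Xv; have [L HL] := bounded_onB Xv.
exists (2 * K + 2 * c ^+ 2 * L) => d Xd.
have := HK _ Xd; have := HL _ Xd; set a := A d v; set b := B d v.
set D := _ + _ => bD aD.
have : c ^+ 2 * b ^+ 2 <= c ^+ 2 * (L * D) by rewrite ler_wpM2l ?sqr_ge0.
have := sqr_ge0 (a + c * b); nra.
Qed.

(** By linearity [f p = f (u n) - f (u n - p)], and both terms have squares of order [16^-n]. *)
Lemma limit_eq0 f u p K : linear_on f -> bounded_on f ->
  (forall n, X (u n)) -> X p ->
  (forall n, A (u n - p) (u n - p) + B (u n - p) (u n - p) <= 2 * 16%:R^-1 ^+ n) ->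
  (forall n, f (u n) ^+ 2 <= K * 16%:R^-1 ^+ n) -> f p = 0.
Proof.
move=> lf [L fL] Xu Xp up fu; apply/eqP; rewrite -sqrf_eq0 eq_le sqr_ge0 andbT.
apply: (@le_geo_le0 _ _ (2 * K + 4 * `|L|)) => n.
have Xd : X (u n - p) by exact: subspaceB.
have := fL _ Xd; rewrite linear_onB//; have := fu n; have := up n.
have := A_ge0 Xd; have := B_ge0 Xd.
set D1 := A _ _; set D2 := B _ _; set g := _ ^+ n => D1_ge0 D2_ge0 D12 h1 h2.
have h3 : L * (D1 + D2) <= `|L| * (2 * g).
  apply: le_trans (_ : `|L| * (D1 + D2) <= _).
    by rewrite ler_wpM2r ?ler_norm// addr_ge0.
  by rewrite ler_wpM2l.
(* Expanded, this says that [f p ^+ 2 <= 2 * f (u n) ^+ 2 + 2 * (f (u n) - f p) ^+ 2]. *)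
have := sqr_ge0 (2 * f (u n) - f p); nra.
Qed.

Definition eigset l : set V :=
  [set u | X u /\ forall v, X v -> A u v = l * B u v].

Lemma eigset_sub l : is_subspace (eigset l).
Proof.
split; first by split=> [|v Xv]; [exact: X_sub.1|rewrite !form0l// mulr0].
move=> c u v [Xu Eu] [Xv Ev]; split=> [|w Xw]; first exact: X_sub.2.
by rewrite !(form_lin Af)// !(form_lin Bf)// Eu// Ev//; ring.
Qed.

Lemma near_minimizer (Y : set V) (f : V -> R) : Y !=set0 ->
  (forall u, Y u -> 0 <= f u) ->
  [/\ forall u, Y u -> inf (f @` Y) <= f u, 0 <= inf (f @` Y) &
    forall e, 0 < e -> exists2 u, Y u & f u <= inf (f @` Y) + e].
Proof.
move=> [y Yy] f0.
have lbf : lbound (f @` Y) 0 by move=> _ [u Yu <-]; exact: f0.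
have infY : has_inf (f @` Y) by split; [exists (f y), y|exists 0].
split=> [u Yu||e e0]; first by apply: ge_inf; [exists 0|exists u].
  by apply: lb_le_inf => //; exists (f y), y.
have [_ [u Yu <-] ue] := inf_adherent e0 infY.
by exists u => //; exact: ltW.
Qed.

(** The point [p] of the eigenspace closest to [w] for [A]. A minimising sequence is Cauchy for [A]
    by the parallelogram identity, hence for [B], which is [A / l] on the eigenspace. *)
Lemma eigset_projection l w : 0 < l -> X w ->
  exists2 p, eigset l p & forall e, eigset l e -> A (w - p) e = 0.
Proof.
move=> l0 Xw; have [E0 EZ] := eigset_sub l.
have XE u : eigset l u -> X u by case.
pose f e := A (w - e) (w - e).
have Xwe e : eigset l e -> X (w - e) by move=> /XE Xe; exact: subspaceB.
have [|e Ee|dle d0 dnear] := @near_minimizer (eigset l) f.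
- by exists 0.
- exact/A_ge0/Xwe.
set d := inf _ in dle d0 dnear.
(* The parallelogram identity gives [A d d <= 4 * c * 16^-n] for a difference [d], and
   [A d d + B d d] is [(l + 1) / l] times [A d d]; this [c] makes the product exactly [16^-n]. *)
pose c := l / (4 * (l + 1)).
have c0 : 0 < c by rewrite divr_gt0//; lra.
have /choice[e He] n : exists e, eigset l e /\ f e <= d + c * 16%:R^-1 ^+ n.
  have /dnear[e Ee fe] : 0 < c * (16%:R^-1 : R) ^+ n.
    by rewrite mulr_gt0// geo_gt0.
  by exists e.
have Ee n : eigset l (e n) by have [] := He n.
have fe n : f (e n) <= d + c * 16%:R^-1 ^+ n by have [] := He n.
have Xe n : X (e n) by exact: XE.
have cauchy n m : (n <= m)%N -> A (e m - e n) (e m - e n) +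
     B (e m - e n) (e m - e n) <= 16%:R^-1 ^+ n.
  move=> nm.
  have [Xd Ed] : eigset l (e m - e n) by apply: subspaceB => //; exact: eigset_sub.
  have -> : B (e m - e n) (e m - e n) = A (e m - e n) (e m - e n) / l.
    by rewrite Ed// mulrC mulKf// gt_eqF.
  have dE : e m - e n = (w - e n) - (w - e m).
    by rewrite opprB [RHS]addrC addrA subrK.
  (* The midpoint is a competitor, so its value is at least the infimum [d]. *)
  have Emid : eigset l (2^-1 *: (e n + e m)).
    by apply: subspaceZ; [exact: eigset_sub|apply: subspaceD => //; exact: eigset_sub].
  have sE : (w - e n) + (w - e m) = 2 *: (w - 2^-1 *: (e n + e m)).
    rewrite scalerBr scalerA divff// scale1r addrACA -opprD.
    by rewrite scaler_nat mulr2n.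
  have le4 : A (e m - e n) (e m - e n) <= 4 * c * 16%:R^-1 ^+ n.
    rewrite {1 2}dE form_parallelogram//; try exact: Xwe.
    rewrite sE formZZ//; last exact: Xwe.
    have := dle _ Emid; have := fe n; have := fe m; rewrite /f.
    have := ler_wpM2l (ltW c0) (@geo_le R _ _ nm); lra.
  have -> : A (e m - e n) (e m - e n) + A (e m - e n) (e m - e n) / l =
      A (e m - e n) (e m - e n) * ((l + 1) / l).
    by field; rewrite gt_eqF.
  apply: le_trans (ler_wpM2r _ le4) _; first by rewrite divr_ge0//; lra.
  rewrite le_eqVlt; apply/orP; left; apply/eqP; rewrite /c.
  by field; rewrite !gt_eqF//; lra.
have [p Xp ep] := AB_complete Xe cauchy.
have Ep : eigset l p.
  split=> // v Xv; apply/eqP; rewrite -subr_eq0; apply/eqP.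
  apply: (@limit_eq0 (fun u => A u v - l * B u v) e p 0) => //.
  - exact: (form_lin (sym_formBZ l) Xv).
  - exact: bounded_onBZ.
  - by move=> n; have [_ ->//] := Ee n; rewrite subrr expr0n mul0r.
exists p => // u Eu; have Xu := XE _ Eu.
(* Minimality up to [c * 16^-n] gives orthogonality to [u] up to [c * 16^-n * A u u] in the square,
   and the limit is exact. *)
apply: (@limit_eq0 (A^~ u) (fun n => w - e n) (w - p) (c * A u u)).
- exact: form_lin.
- exact: bounded_onA.
- by move=> n; exact: Xwe.
- exact: Xwe.
- move=> n; rewrite (_ : w - e n - (w - p) = p - e n); last first.
    by rewrite opprB [LHS]addrC addrA subrK.
  rewrite (_ : p - e n = -1 *: (e n - p)); last by rewrite scaleN1r opprB.
  have Xd : X (e n - p) by exact: subspaceB.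
  have := ep n; rewrite !formZZ//.
  by rewrite sqrrN expr1n !mul1r.
move=> n; rewrite mulrAC.
apply: (near_minimum_orthogonal Af (d := d)) => //;
  [exact: Xwe|exact: A_ge0| |exact: fe].
move=> t; have -> : w - e n - t *: u = w - (t *: u + e n).
  by rewrite opprD addrAC addrA.
by apply: dle; exact: EZ.
Qed.

(** Compactness of [B] relative to [A]: where finitely many [B]-bounded functionals vanish, [B] is
    at most [e * A]. *)
Hypothesis AB_compact : forall e, 0 < e ->
  exists (I : finType) (l : I -> V -> R) (K : R),
  [/\ forall i, linear_on (l i),
      forall i u, X u -> l i u ^+ 2 <= K * B u u &
      forall u, X u -> B u u <= e * A u u + \sum_i l i u ^+ 2].

Definition annihilator (N : set V) : set V :=
  [set w | X w /\ forall v, N v -> A w v = 0].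

Lemma annihilator_sub N : N `<=` X -> is_subspace (annihilator N).
Proof.
move=> NX; split.
  by split=> [|v /NX Xv]; [exact: X_sub.1|rewrite form0l].
move=> c u v [Xu Nu] [Xv Nv]; split=> [|w Nw]; first exact: X_sub.2.
by rewrite (form_lin Af) ?Nu ?Nv ?mulr0 ?addr0//; exact: NX.
Qed.

(* With [B w w = 1] for both terms of a minimising sequence, the parallelogram
   identity bounds [A d d] for their difference [d] by the defects plus
   [L * B d d], and compactness absorbs half of the latter. *)
Lemma annihilator_minimizer N : N `<=` X ->
  (exists2 w, annihilator N w & B w w != 0) ->
  exists L w, [/\ annihilator N w, B w w != 0,
    forall u, annihilator N u -> A w u = L * B w u &
    forall u, annihilator N u -> L * B u u <= A u u].
Proof.
move=> NX [w0 Mw0 Bw0]; set M := annihilator N in Mw0 *.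
have sM : is_subspace M by exact: annihilator_sub.
have MX u : M u -> X u by case.
pose S := [set w | M w /\ B w w = 1].
have unit_scale u : M u -> B u u != 0 -> S ((Num.sqrt (B u u))^-1 *: u).
  move=> Mu Bu; split; first exact: subspaceZ.
  rewrite formZZ//; last exact: MX.
  by rewrite exprVn sqr_sqrtr ?mulVf// B_ge0//; exact: MX.
have [||Lle L0 Lnear] := @near_minimizer S (fun u => A u u).
- by eexists; exact: unit_scale Mw0 Bw0.
- by move=> u [/MX Xu _]; exact: A_ge0.
set L := inf _ in Lle L0 Lnear.
have q0 u : M u -> L * B u u <= A u u.
  move=> Mu; have Xu := MX _ Mu.
  have [->|Bu] := eqVneq (B u u) 0; first by rewrite mulr0 A_ge0.
  have Bu0 : 0 < B u u by rewrite lt_def Bu B_ge0.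
  have := Lle _ (unit_scale _ Mu Bu); rewrite formZZ//.
  by rewrite exprVn sqr_sqrtr ?(ltW Bu0)// mulrC ler_pdivlMr.
(* With this [e], [e * (L + 1) = 1/2], so the [A] part of the compactness bound for [L * B d d] is
   at most half of [A d d]. *)
have e0 : 0 < (2 * (L + 1))^-1 by rewrite invr_gt0; lra.
have [I [l [K [ll lK lB]]]] := AB_compact e0.
have [p pE p0] : exists2 p : R, p = #|I|%:R & 0 <= p by exists #|I|%:R.
have /choice[x Sx] n : exists x, S x /\ A x x <= L + 32^-1 * 16%:R^-1 ^+ n.
  have /Lnear[x Sx Ax] : 0 < 32^-1 * (16%:R^-1 : R) ^+ n.
    by rewrite mulr_gt0 ?geo_gt0.
  by exists x.
have Mx n : M (x n) by have [[]] := Sx n.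
have Xx n : X (x n) by exact: MX.
have Bx n : B (x n) (x n) = 1 by have [[]] := Sx n.
have Ax n : A (x n) (x n) <= L + 32^-1 * 16%:R^-1 ^+ n by have [] := Sx n.
(* From [l i (x n) ^+ 2 <= K] follows the bound [|K| + 1] on the absolute value. *)
have [|c xc] := @bounded_sequences_cluster R I (fun n i => l i (x n)) (`|K| + 1).
  move=> n i; have := lK i _ (Xx n); rewrite Bx mulr1 => lK1.
  have := ler_norm K; have := normr_ge0 K.
  by rewrite ler_norml; move=> *; apply/andP; split; nra.
(* Chosen so that [(4 * L + 1) * p * (4 * e' * g) <= g / 2] below; [p + 1] is positive even when
   there are no functionals. *)
have [e' e'0 e'E] : exists2 e' : R, 0 < e' & 8 * (p + 1) * (4 * L + 1) * e' = 1.
  have K0 : 0 < 8 * (p + 1) * (4 * L + 1).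
    by rewrite !mulr_gt0//; lra.
  by exists (8 * (p + 1) * (4 * L + 1))^-1; rewrite ?invr_gt0// divff ?gt_eqF.
(* Since [h n >= n], passing to [x (h n)] keeps the defect below [32^-1 * 16^-n], while every
   functional is now close to its cluster value. *)
have /choice[h Hh] n : exists m, (n <= m)%N /\
    forall i, (l i (x m) - c i) ^+ 2 <= e' * 16%:R^-1 ^+ n.
  have [|m nm xm] := xc (e' * 16%:R^-1 ^+ n) n.
    by rewrite mulr_gt0 ?geo_gt0.
  by exists m.
pose w n := x (h n).
have Mw n : M (w n) by exact: Mx.
have Xw n : X (w n) by exact: Xx.
have Bw n : B (w n) (w n) = 1 by exact: Bx.
have Aw n : A (w n) (w n) <= L + 32^-1 * 16%:R^-1 ^+ n.
  apply: le_trans (Ax _) _; rewrite lerD2l ler_pM2l//; exact/geo_le/(Hh n).1.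
have wc n i : (l i (w n) - c i) ^+ 2 <= e' * 16%:R^-1 ^+ n by have [] := Hh n.
have cauchy n m : (n <= m)%N -> A (w m - w n) (w m - w n) +
     B (w m - w n) (w m - w n) <= 16%:R^-1 ^+ n.
  move=> nm; set d := w m - w n.
  have Xd : X d by exact: subspaceB.
  have Ms : M (w m + w n) by exact: subspaceD.
  have Ad : A d d = 2 * A (w m) (w m) + 2 * A (w n) (w n)
      - A (w m + w n) (w m + w n) by exact: form_parallelogram.
  have Bd : B d d = 2 * B (w m) (w m) + 2 * B (w n) (w n)
      - B (w m + w n) (w m + w n) by exact: form_parallelogram.
  have S1 : \sum_i l i d ^+ 2 <= p * (4 * e' * 16%:R^-1 ^+ n).
    rewrite pE -sum1_card natr_sum mulr_suml; apply: ler_sum => i _.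
    rewrite mul1r /d linear_onB//; have := wc n i; have := wc m i.
    have := ler_wpM2l (ltW e'0) (@geo_le R _ _ nm).
    have := sqr_ge0 ((l i (w m) - c i) + (l i (w n) - c i)); nra.
  have := lB _ Xd; set T := \sum_i _ in S1 *.
  have := q0 _ Ms; have := A_ge0 Xd; have := B_ge0 Xd.
  have := @geo_le R _ _ nm.
  have := Aw n; have := Aw m; rewrite !Bw in Bd; move: Ad Bd S1.
  set e := (2 * (L + 1))^-1; set g := _ ^+ n; set g' := _ ^+ m.
  move=> Ad Bd T_le Am An g'g Bd0 Ad0 Ls BdT.
  have eE : e * (L + 1) = 2^-1 by rewrite /e; field; lra.
  have g0 : 0 < g by exact: geo_gt0.
  (* The sum [w m + w n] lies in [M], where [L * B <= A], and its [B] value is [4 - B d d]. *)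
  have Ale : A d d <= 8^-1 * g + L * B d d.
    have -> : B d d = 4 - B (w m + w n) (w m + w n) by lra.
    lra.
  have LB : L * B d d <= 2^-1 * A d d + L * T.
    have : 0 <= L * (e * A d d + T - B d d) by rewrite mulr_ge0// subr_ge0.
    have : 0 <= e * A d d by rewrite mulr_ge0// ltW.
    have : e * (L + 1) * A d d = 2^-1 * A d d by rewrite eE.
    lra.
  have eA : e * A d d <= 2^-1 * A d d by rewrite ler_wpM2r//; nra.
  have LT : (4 * L + 1) * T <= 2^-1 * g.
    have : (4 * L + 1) * T <= (4 * L + 1) * (p * (4 * e' * g)).
      by rewrite ler_wpM2l//; lra.
    have : 0 <= (4 * L + 1) * (4 * e' * g).
      by rewrite !mulr_ge0 ?(ltW e'0) ?(ltW g0)//; lra.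
    have : 8 * (p + 1) * (4 * L + 1) * e' * g = g by rewrite e'E mul1r.
    lra.
  have T0 : 0 <= T by apply: sumr_ge0 => i _; exact: sqr_ge0.
  have LT0 : 0 <= L * T by exact: mulr_ge0.
  (* Together [A d d <= g / 4 + 2 * L * T] and [B d d <= A d d / 2 + T], so the total is at most
     [3/8 * g + (3 * L + 1) * T <= 7/8 * g]. *)
  lra.
have [w1 Xw1 ww1] := AB_complete Xw cauchy.
have Mw1 : M w1.
  split=> // v Nv.
  apply: (@limit_eq0 (A^~ v) w w1 0) => //.
  - exact/(form_lin Af)/NX.
  - exact/bounded_onA/NX.
  - by move=> n; have [_ ->//] := Mw n; rewrite expr0n mul0r.
have qf := sym_formBZ L.
exists L, w1; split=> //.
  (* If [B w1 w1 = 0], Cauchy-Schwarz also kills [B (w 1) w1], so [w 1 - w1] has [B] value 1,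
     against the bound [2/16]. Index 0 would only give the bound 2. *)
  apply/eqP => Bw1.
  have Xd1 : X (w 1 - w1) by exact: subspaceB.
  have := ww1 1%N; rewrite expr1 (formBB Bf)// Bw Bw1.
  have := A_ge0 Xd1; have := form_continuous Bf B_ge0 Xw1 (Xw 1%N).
  rewrite Bw1 mul0r; have := sqr_ge0 (B (w 1%N) w1); nra.
(* The form [A - L B] is nonnegative on [M] and at most [32^-1 * 16^-n] at [w n], so Cauchy-Schwarz
   makes its pairing with [u] vanish in the limit. *)
move=> u Mu; have Xu := MX _ Mu.
apply/eqP; rewrite -subr_eq0; apply/eqP.
apply: (@limit_eq0 (fun z => A z u - L * B z u) w w1
    (32^-1 * (A u u - L * B u u))) => //.
- exact: (form_lin qf Xu).
- exact: bounded_onBZ.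
move=> n; rewrite mulrAC.
have q0' v : M v -> 0 <= A v v - L * B v v by move=> Mv; rewrite subr_ge0 q0.
have := form_cauchy_schwarz qf MX sM q0' (Mw n) Mu; rewrite /= Bw mulr1.
move=> /le_trans; apply; rewrite ler_wpM2r ?q0'//.
by rewrite lerBlDl.
Qed.

(** * Sums of eigenspaces and the bound on their annihilator *)

Variable lam : nat -> R.
Hypothesis lam1_gt0 : 0 < lam 1%N.
Hypothesis lam_incr : forall j, (1 <= j)%N -> lam j < lam j.+1.
Hypothesis lam_all : forall l u, eigset l u -> B u u != 0 ->
  exists2 j, (1 <= j)%N & l = lam j.

(** Written like [Nsp], so that the two agree by conversion when [A] and [B] are [ip] and [mass]. *)
Definition eigsum k : set V :=
  [set u | exists v : nat -> V,
     (forall j, (1 <= j <= k)%N -> eigset (lam j) (v j)) /\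
     u = \sum_(1 <= j < k.+1) v j].

Lemma lam_lt i j : (1 <= i)%N -> (i < j)%N -> lam i < lam j.
Proof.
move=> i1; elim: j => // j IH; rewrite ltnS leq_eqVlt => /predU1P[<-|ij].
  exact: lam_incr.
by apply: lt_trans (IH ij) _; apply: lam_incr; exact: leq_trans (ltnW ij).
Qed.

Lemma lam_gt0 j : (1 <= j)%N -> 0 < lam j.
Proof.
rewrite leq_eqVlt => /predU1P[<-//|j1].
exact: lt_trans (lam_lt (leqnn 1) j1).
Qed.

Lemma eigsum0 u : eigsum 0 u -> u = 0.
Proof. by move=> [v [_ ->]]; rewrite big_geq. Qed.

Lemma eigsum00 : eigsum 0 0.
Proof. by exists (fun=> 0); split; [case|rewrite big_geq]. Qed.

Lemma eigsumS k u : eigsum k.+1 u ->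
  exists n p, [/\ eigsum k n, eigset (lam k.+1) p & u = n + p].
Proof.
move=> [v [Ev ->]]; exists (\sum_(1 <= j < k.+1) v j), (v k.+1); split.
- exists v; split=> // j /andP[j1 jk]; apply: Ev.
  by rewrite j1 (leq_trans jk).
- by apply: Ev; rewrite leqnn.
- by rewrite big_nat_recr.
Qed.

Lemma eigsum_add k n p : eigsum k n -> eigset (lam k.+1) p ->
  eigsum k.+1 (n + p).
Proof.
move=> [v [Ev ->]] Ep; exists (fun j => if j == k.+1 then p else v j); split.
  move=> j /andP[j1 jk]; case: eqP => [->//|/eqP jk1].
  by apply: Ev; rewrite j1 -ltnS ltn_neqAle jk1.
rewrite [RHS]big_nat_recr//; congr (_ + _); last by rewrite eqxx.
by apply: eq_big_nat => j /andP[_ jk]; rewrite ltn_eqF.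
Qed.

Lemma eigset0 l : eigset l 0.
Proof. exact: (eigset_sub l).1. Qed.

Lemma eigset_eigsum j k u : (1 <= j <= k)%N -> eigset (lam j) u -> eigsum k u.
Proof.
move=> /andP[j1 jk] Eu; elim: k jk => [|k IH].
  by rewrite leqn0 => /eqP j0; rewrite j0 in j1.
rewrite leq_eqVlt => /predU1P[jk|jk]; last first.
  by rewrite -(addr0 u); apply: eigsum_add; [exact: IH|exact: eigset0].
rewrite -(add0r u); apply: eigsum_add; last by rewrite -jk.
exists (fun=> 0); split; first by move=> *; exact: eigset0.
by rewrite big1.
Qed.

Lemma eigsum_X k u : eigsum k u -> X u.
Proof.
elim: k u => [u /eigsum0 ->|k IH u /eigsumS[n [p [/IH Xn [Xp _] ->]]]].
  exact: X_sub.1.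
exact: subspaceD.
Qed.

Lemma eigset_orth l l' u v : l != l' -> eigset l u -> eigset l' v ->
  A u v = 0 /\ B u v = 0.
Proof.
move=> ll' [Xu Eu] [Xv Ev]; have E1 := Eu _ Xv; have := Ev _ Xu.
rewrite (formC Af) (formC Bf) E1 => /eqP; rewrite -subr_eq0 -mulrBl mulf_eq0.
by rewrite subr_eq0 (negbTE ll')/= => /eqP ->; rewrite mulr0.
Qed.

Lemma eigsum_orth k j u p : (k < j)%N -> eigsum k u -> eigset (lam j) p ->
  A u p = 0 /\ B u p = 0.
Proof.
move=> + + Ep; have Xp := Ep.1; elim: k u => [u _ /eigsum0 ->|k IH u kj].
  by rewrite !form0l.
move=> /eigsumS[n [p' [Sn Ep' ->]]]; have Xn := eigsum_X Sn; have Xp' := Ep'.1.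
have [An Bn] := IH _ (ltnW kj) Sn.
have [|Ap Bp] := @eigset_orth (lam k.+1) (lam j) p' p _ Ep' Ep.
  by rewrite lt_eqF// lam_lt.
by rewrite !formDl// An Bn Ap Bp addr0.
Qed.

(** On an eigenvector [p] of [lam j], [A p w = lam j * B p w] with [lam j > 0], so orthogonality for
    [A] implies it for [B]. *)
Lemma annihilator_eigsum_orth k w v : annihilator (eigsum k) w -> eigsum k v ->
  A w v = 0 /\ B w v = 0.
Proof.
move=> [Xw Nw] Sv; split; first exact: Nw.
have {}Nw u : eigsum k u -> A w u = 0 by exact: Nw.
elim: k v Nw Sv => [v _ /eigsum0 ->|k IH v Nw].
  by rewrite (formC Bf) form0l.
move=> /eigsumS[n [p [Sn Ep ->]]]; have Xn := eigsum_X Sn; have Xp := Ep.1.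
rewrite (formC Bf) formDl// (formC Bf n) IH//; last first.
  move=> u Su; apply: Nw; rewrite -(addr0 u); apply: eigsum_add => //.
  exact: eigset0.
have : A p w = 0.
  by rewrite (formC Af); apply: Nw; apply: eigset_eigsum Ep; rewrite leqnn.
by rewrite Ep.2// add0r => /eqP; rewrite mulf_eq0 gt_eqF ?lam_gt0//= => /eqP.
Qed.

(** The components are orthogonal for both forms, and on the [j]-th one [A] is [lam j * B] with
    [lam j <= lam k]. *)
Lemma eigsum_le k u : (1 <= k)%N -> eigsum k u -> A u u <= lam k * B u u.
Proof.
case: k => // k _; elim: k u => [|k IH] u /eigsumS[n [p [Sn Ep ->]]].
  by move/eigsum0: Sn => ->; rewrite add0r Ep.2//; case: Ep.
have Xn := eigsum_X Sn; have Xp := Ep.1.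
have [An Bn] := eigsum_orth (ltnSn _) Sn Ep.
rewrite !formDD// An Bn mulr0 !addr0 Ep.2// mulrDr lerD2r.
apply: le_trans (IH _ Sn) _; rewrite ler_wpM2r ?B_ge0//.
exact/ltW/lam_incr.
Qed.

(** The remainder is projected on one more eigenspace at a time; subtracting that projection keeps
    orthogonality to the earlier eigenspaces. *)
Lemma eigsum_decomposition k w : X w ->
  exists2 n, eigsum k n & annihilator (eigsum k) (w - n).
Proof.
move=> Xw; elim: k => [|k [n Sn [Xr Nr]]].
  exists 0; first exact: eigsum00.
  by rewrite subr0; split=> // v /eigsum0 ->; rewrite (formC Af) form0l.
have [p Ep pr] := eigset_projection (lam_gt0 (ltn0Sn k)) Xr.
have Xp := Ep.1.
exists (n + p); first exact: eigsum_add.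
rewrite opprD addrA; split; first exact: subspaceB.
move=> _ /eigsumS[m [e [Sm Ee ->]]]; have Xm := eigsum_X Sm; have Xe := Ee.1.
have Xrp : X (w - n - p) by exact: subspaceB.
rewrite (formC Af) formDl// (formC Af e) pr// (formC Af) formBl// Nr// addr0.
by rewrite (formC Af p) (eigsum_orth (ltnSn _) Sm Ep).1 subrr.
Qed.

(** The least quotient [L] is attained at some [e], which turns out to be an eigenvector, so
    [L = lam j]. If [j <= k], then [e] would lie in [eigsum k] and be [B]-orthogonal to itself. *)
Theorem annihilator_eigsum_ge k w : annihilator (eigsum k) w ->
  lam k.+1 * B w w <= A w w.
Proof.
move=> Mw; have Xw := Mw.1.
have [->|Bw] := eqVneq (B w w) 0; first by rewrite mulr0 A_ge0.
have [||L [e [Me Be Ee Lle]]] := @annihilator_minimizer (eigsum k).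
- by move=> u; exact: eigsum_X.
- by exists w.
have Xe := Me.1.
(* The equation for [e] is known against the annihilator only; on the component in [eigsum k] both
   sides vanish. *)
have Eig : eigset L e.
  split=> // v Xv; have [n Sn Mr] := eigsum_decomposition k Xv.
  have Xn := eigsum_X Sn; have [Aen Ben] := annihilator_eigsum_orth Me Sn.
  have -> : v = n + (v - n) by rewrite addrC subrK.
  move: Mr; set r := v - n => Mr; have Xr := Mr.1.
  rewrite (formC Af) (formC Bf) (formDl Af)// (formDl Bf)//.
  rewrite (formC Af n) (formC Bf n) Aen Ben.
  by rewrite !add0r (formC Af) (formC Bf) Ee.
have [j j1 LE] := lam_all Eig Be.
apply: le_trans (Lle _ Mw); rewrite ler_wpM2r ?B_ge0// LE.
have [jk|] := leqP j k; last first.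
  by rewrite leq_eqVlt => /predU1P[->//|kj]; exact/ltW/lam_lt.
rewrite LE in Eig; have [_] : A e e = 0 /\ B e e = 0.
  by apply: annihilator_eigsum_orth Me _; apply: eigset_eigsum Eig; rewrite j1.
by move/eqP; rewrite (negbTE Be).
Qed.

End forms.

(** * Square integrable functions *)

Section square_integrable.
Context d (T : measurableType d) (R : realType).
Variable mu : {measure set T -> \bar R}.
Implicit Types f g h : T -> R.

Lemma Lfun2P f : f \in Lfun mu 2%:E <->
  measurable_fun setT f /\ (\int[mu]_x (f x ^+ 2)%:E < +oo)%E.
Proof.
split=> [fL|[mf foo]].
  split; first by move: fL; rewrite inE => /andP[/[!inE]].
  exact: integrable_lty (Lfun2_integrable_sqr fL).
rewrite inE; apply/andP; split; rewrite inE//= /finite_norm unlock/=.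
rewrite (_ : (fun x => _) = (fun x => (f x ^+ 2)%:E)).
  exact: poweR_lty.
apply/funext => x /=; rewrite powR_mulrn//.
by rewrite real_normK ?num_real.
Qed.

Lemma Lfun2_measurable f : f \in Lfun mu 2%:E -> measurable_fun setT f.
Proof. by move=> /Lfun2P[]. Qed.

Lemma Lfun2_lin c f g : f \in Lfun mu 2%:E -> g \in Lfun mu 2%:E ->
  c *: f + g \in Lfun mu 2%:E.
Proof. by have [_ +] := @Lfun_submod_closed _ T R mu 2%:E (lee1n 2); exact. Qed.

Lemma Lfun2_0 : (0 : T -> R) \in Lfun mu 2%:E.
Proof. by have [+ _] := @Lfun_submod_closed _ T R mu 2%:E (lee1n 2). Qed.

Lemma Lfun2B f g : f \in Lfun mu 2%:E -> g \in Lfun mu 2%:E ->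
  f - g \in Lfun mu 2%:E.
Proof. by move=> ? ?; rewrite addrC -scaleN1r Lfun2_lin. Qed.

Lemma Lfun2_le f g : measurable_fun setT f -> (forall x, `|f x| <= `|g x|) ->
  g \in Lfun mu 2%:E -> f \in Lfun mu 2%:E.
Proof.
move=> mf fg /Lfun2P[mg goo]; apply/Lfun2P; split=> //.
apply: le_lt_trans goo; apply: ge0_le_integral => //.
- by move=> x _; rewrite lee_fin sqr_ge0.
- by apply/measurable_EFinP; exact: measurable_funX.
- by apply/measurable_EFinP; exact: measurable_funX.
move=> x _; rewrite lee_fin -(real_normK (num_real (f x))).
by rewrite -(real_normK (num_real (g x))) lerXn2r ?nnegrE.
Qed.

Lemma Lfun2_integrableM (D : set T) f g : measurable D ->
  f \in Lfun mu 2%:E -> g \in Lfun mu 2%:E ->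
  mu.-integrable D (EFin \o (fun x => f x * g x)).
Proof.
move=> mD fL gL; apply: (@integrableS _ _ _ _ setT) => //.
exact/Lfun1_integrable/Lfun2_mul_Lfun1.
Qed.

Lemma RintegralM_lin (D : set T) c f g h : measurable D ->
  f \in Lfun mu 2%:E -> g \in Lfun mu 2%:E -> h \in Lfun mu 2%:E ->
  \int[mu]_(x in D) ((c *: f + g) x * h x) =
  c * \int[mu]_(x in D) (f x * h x) + \int[mu]_(x in D) (g x * h x).
Proof.
move=> mD fL gL hL; rewrite -RintegralZl//; last exact: Lfun2_integrableM.
rewrite -RintegralD//; last 2 first.
- apply: (@eq_integrable _ _ _ mu _ mD (fun x => c%:E * (f x * h x)%:E)%E) => //.
  exact/integrableZl/Lfun2_integrableM.
- exact: Lfun2_integrableM.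
by apply: eq_Rintegral => x _; rewrite mulrDl /= -mulrA.
Qed.

Lemma Rintegral_sqE f : f \in Lfun mu 2%:E ->
  (\int[mu]_x (f x * f x))%:E = (\int[mu]_x (f x ^+ 2)%:E)%E.
Proof.
move=> fL; rewrite fineK//; exact/integrable_fin_num/Lfun2_integrableM.
Qed.

(* [2^n |u_{n+1} - u_n| <= sqrt M] with [M] the a.e. finite sum of the
   [4^n (u_{n+1} - u_n)^2]. *)
Lemma L2_fast_cauchy_ae_cvg (u : nat -> T -> R) :
  (forall n, measurable_fun setT (u n)) ->
  (forall n, \int[mu]_x ((u n.+1 x - u n x) ^+ 2)%:E <=
             (16%:R^-1 ^+ n)%:E)%E ->
  {ae mu, forall x, cvgn (u ^~ x)}.
Proof.
move=> mu_ du.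
pose F n x := (4 ^+ n * (u n.+1 x - u n x) ^+ 2)%:E : \bar R.
have F0 n x : (0 <= F n x)%E by rewrite lee_fin mulr_ge0// sqr_ge0.
have mF n : measurable_fun setT (F n).
  apply/measurable_EFinP/measurable_funM => //.
  by apply: measurable_funX; exact: measurable_funB.
pose G x := (\sum_(n <oo) F n x)%E.
have G0 x : (0 <= G x)%E by exact: nneseries_ge0.
have mG : measurable_fun setT G by exact: ge0_emeasurable_sum.
have Goo : (\int[mu]_x G x <= 2%:E)%E.
  rewrite integral_nneseries//.
  apply: lime_le; first by apply: is_cvg_nneseries => n *; exact: integral_ge0.
  near=> n.
  (* Each term integrates to at most [4^i * 16^-i = 4^-i], and these sum to at most [4/3]. *)
  apply: (@le_trans _ _ (\sum_(0 <= i < n) (4^-1 ^+ i)%:E)%E).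
    apply: lee_sum => i _; rewrite /F.
    under eq_integral do rewrite EFinM.
    rewrite ge0_integralZl//; last 2 first.
    - apply/measurable_EFinP; apply: measurable_funX; exact: measurable_funB.
    - by move=> x _; rewrite lee_fin sqr_ge0.
    apply: le_trans (lee_wpmul2l _ (du i)) _; first by rewrite lee_fin.
    rewrite -EFinM -exprMn lee_fin.
    by rewrite (_ : 4 * 16^-1 = 4^-1 :> R)//; field.
  rewrite sumEFin lee_fin.
  suff -> : \sum_(0 <= i < n) (4^-1 ^+ i) = (4 - 4 * 4^-1 ^+ n) / 3 :> R.
    have : 0 <= (4^-1 : R) ^+ n by exact: exprn_ge0.
    lra.
  elim: (n) => [|m IH]; first by rewrite big_geq// expr0; lra.
  by rewrite big_nat_recr//= IH exprSr; lra.
have : mu.-integrable setT G.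
  apply/integrableP; split=> //; apply: le_lt_trans (ltry 2).
  by under eq_integral do rewrite gee0_abs//.
move=> /(integrable_ae measurableT); apply: filterS => x /(_ Logic.I) Gx.
pose M := fine (G x).
have M0 : 0 <= M by exact: fine_ge0.
have FM n : 4 ^+ n * (u n.+1 x - u n x) ^+ 2 <= M.
  rewrite -lee_fin fineK//; apply: le_trans (nneseries_lim_ge n.+1 _).
    by rewrite big_nat_recr//= leeDr// sume_ge0.
  by [].
have : cvgn (series (telescope (u ^~ x))).
  apply: normed_cvg; apply: (@series_le_cvg _ _ (geometric (Num.sqrt M) 2^-1)).
  - by move=> n /=.
  - by move=> n; rewrite /geometric /= mulr_ge0 ?sqrtr_ge0.
  - move=> n /=; rewrite -(@ler_pXn2r _ 2) ?nnegrE ?mulr_ge0 ?sqrtr_ge0//.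
    rewrite real_normK ?num_real// exprMn sqr_sqrtr// !exprVn exprAC.
    by rewrite ler_pdivlMr ?exprn_gt0// mulrC (_ : 2 ^+ 2 = 4)//; ring.
  by apply: is_cvg_geometric_series; rewrite ger0_norm; lra.
rewrite telescopeK => /(is_cvgD (is_cvg_cst (u 0%N x))).
rewrite (_ : _ + _ = u ^~ x)//; apply/funext => n /=.
by rewrite /GRing.add/= addrC subrK.
Unshelve. all: by end_near.
Qed.

(** Fatou's lemma for the squares of [u (m + n) - u n]; the shift by [n] puts every index in the
    range of the bound. *)
Lemma L2_fatou (u : nat -> T -> R) (p : T -> R) (n : nat) (c : R) :
  (forall m, measurable_fun setT (u m)) -> measurable_fun setT p ->
  {ae mu, forall x, u m x @[m --> \oo] --> p x} ->
  (forall m, (n <= m)%N -> \int[mu]_x ((u m x - u n x) ^+ 2)%:E <= c%:E)%E ->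
  (\int[mu]_x ((u n x - p x) ^+ 2)%:E <= c%:E)%E.
Proof.
move=> mu_ mp up uc.
pose F m x := ((u (m + n)%N x - u n x) ^+ 2)%:E : \bar R.
have mF m : measurable_fun setT (F m).
  by apply/measurable_EFinP/measurable_funX/measurable_funB.
have F0 m x : (0 <= F m x)%E by rewrite lee_fin sqr_ge0.
have lF : (\int[mu]_x limn_einf (F^~ x) <= c%:E)%E.
  apply: (le_trans (fatou mu measurableT mF _)) => //.
  rewrite limn_einf_lim; apply: lime_le; first exact: is_cvg_einfs.
  apply: nearW => k.
  apply: le_trans (ereal_inf_lbound _) (uc (k + n)%N _); rewrite ?leq_addl//.
  by exists k => /=.
apply: le_trans lF; rewrite le_eqVlt; apply/orP; left; apply/eqP.
apply: ge0_ae_eq_integral => //.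
- by apply/measurable_EFinP/measurable_funX/measurable_funB.
- rewrite /limn_einf; apply: measurableT_comp => //.
  apply: measurable_fun_limn_esup => m; exact: measurableT_comp.
- by move=> x _; rewrite lee_fin sqr_ge0.
- move=> x _; rewrite limn_einf_lim; apply: lime_ge; first exact: is_cvg_einfs.
  by apply: nearW => k; apply: le_ereal_inf_tmp => _ [m _ <-].
apply: filterS up => x ux _.
have : F m x @[m --> \oo] --> ((p x - u n x) ^+ 2)%:E.
  apply: cvg_EFin; first exact: nearW.
  have ux' : u (m + n)%N x @[m --> \oo] --> p x by rewrite (cvg_shiftn n (u ^~ x)).
  have h : u (m + n)%N x - u n x @[m --> \oo] --> p x - u n x.
    exact: cvgB ux' (cvg_cst _).
  by rewrite expr2; exact: (cvgM h h).
by move=> /cvg_limn_einf_sup[-> _]; rewrite -sqrrN opprB.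
Qed.

End square_integrable.

(** * Measurability of boxes, open sets and the Euclidean norm *)

Section rV_measurability.
Context {R : realType} {n : nat}.

Lemma measurable_rV_box (A : 'I_n -> set (measurableTypeR R)) :
  (forall i, measurable (A i)) ->
  measurable [set x : 'rV[R]_n | forall i, A i (x ord0 i)].
Proof.
move=> mA; rewrite (_ : mkset _ = \bigcap_(i in [set: 'I_n])
    (fun x : 'rV[R]_n => x ord0 i) @^-1` A i).
  apply: fin_bigcap_measurable => // i _.
  rewrite -[X in measurable X]setTI.
  exact: (measurable_coord i measurableT (mA i)).
by apply/seteqP; split => x /= H i; [move=> _; exact: H|exact: (H i)].
Qed.

(** The sigma-algebra is generated by the coordinates, and an open set is the countable union of the
    boxes with rational centre and half-side [1 / (k + 1)] that it contains. *)
Lemma open_measurable_rV (A : set 'rV[R]_n) : open A -> measurable A.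
Proof.
move=> oA.
pose I (p : {ffun 'I_n -> rat} * nat) i : set R :=
  [set` `]ratr (p.1 i) - p.2.+1%:R^-1, ratr (p.1 i) + p.2.+1%:R^-1[%R].
pose F p : set 'rV[R]_n := [set x | forall i, I p i (x ord0 i)].
have -> : A = \bigcup_p (if `[< F p `<=` A >] then F p else set0).
  apply/seteqP; split=> [x Ax|x [p _]]; last by case: asboolP => // FA /FA.
  have /nbhs_ballP[e /= e0 xe] : nbhs x A by exact: open_nbhs_nbhs.
  (* A box of half-side below [e / 2] that contains [x] lies in the sup-norm ball of radius [e] at
     [x]. *)
  have /ltr_add_invr[k] : 0 < e / 2 by rewrite divr_gt0.
  rewrite add0r => ke.
  have k0 : 0 < k.+1%:R^-1 :> R by rewrite invr_gt0.
  have /choice[q xq] i : exists q : rat, ratr q \in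
      `]x ord0 i - k.+1%:R^-1, x ord0 i + k.+1%:R^-1[.
    by apply: rat_in_itvoo; rewrite ltrBlDr -addrA ltrDl addr_gt0.
  have Fx y i : I (finfun q, k) i y = (`|ratr (q i) - y| < k.+1%:R^-1) :> Prop.
    rewrite /I/= ffunE in_itv/= ltr_distlC.
    by [].
  have qx i : `|ratr (q i) - x ord0 i| < k.+1%:R^-1.
    by have := xq i; rewrite in_itv/= ltr_distl.
  exists (finfun q, k) => //; rewrite asboolT; first by move=> i; rewrite Fx.
  move=> y Fy; apply: xe; split=> // i j; rewrite (ord1 i) /ball/=.
  have := Fy j; rewrite Fx => qy.
  rewrite (le_lt_trans (ler_distD (ratr (q j)) _ _))// (splitr e) ltrD//.
    by rewrite distrC (lt_trans (qx j)).
  exact: lt_trans ke.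
apply: countable_bigcupT_measurable => [|p]; first exact: countableP.
by case: asboolP => // _; apply: measurable_rV_box => i; exact: measurable_itv.
Qed.

Lemma measurable_enorm : measurable_fun setT (@enorm R n).
Proof.
rewrite /enorm /dotp.
apply: (measurableT_comp (continuous_measurable_fun (@sqrt_continuous R))).
apply: measurable_sum => i.
by apply: measurable_funM; exact: measurable_coord.
Qed.

End rV_measurability.

(** * The Gagliardo form as an L^2 inner product *)

Section slope.
Context {R : realType} {N : nat}.
Variable s : R.
Local Notation mu := (@lebesgue_rV R N).
Implicit Types u v : 'rV[R]_N -> R.

(** Half of the exponent [N + 2 s] is used, so that the Gagliardo integrand of [u] and [v] is the
    product of their slopes. *)
Definition slope u (z : 'rV[R]_N * 'rV[R]_N) : R :=
  (u z.1 - u z.2) * enorm (z.1 - z.2) `^ (- ((N%:R + 2 * s) / 2)).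

Lemma gagliardo_slope u v z : gagliardo_integrand s u v z = slope u z * slope v z.
Proof.
rewrite /gagliardo_integrand /slope mulrACA; congr (_ * _).
rewrite -expr2 -powR_mulrn ?powR_ge0// -powRrM -powRN; congr (_ `^ _).
by field.
Qed.

Lemma slope_lin c u v : slope (c *: u + v) = c *: slope u + slope v.
Proof.
apply/funext => z; rewrite /slope.
have Z x : (c *: u + v) x = c * u x + v x by [].
have -> : (c *: slope u + slope v) z = c * slope u z + slope v z by [].
by rewrite !Z /slope; ring.
Qed.

Lemma slopeB u v : slope (u - v) = slope u - slope v.
Proof. by rewrite addrC -scaleN1r slope_lin scaleN1r addrC. Qed.

Lemma measurable_slope u : measurable_fun setT u -> measurable_fun setT (slope u).
Proof.
move=> mu_; apply: measurable_funM.
  apply: measurable_funB.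
    exact: (measurableT_comp mu_ measurable_fst).
  exact: (measurableT_comp mu_ measurable_snd).
apply: (measurableT_comp (measurable_powR _)).
apply: (measurableT_comp measurable_enorm).
apply: measurable_fun_rVP => i.
rewrite (_ : (fun x => _) = (fun z : 'rV[R]_N * 'rV[R]_N => z.1 ord0 i - z.2 ord0 i)).
  apply: measurable_funB.
    exact: (measurableT_comp (measurable_coord i) measurable_fst).
  exact: (measurableT_comp (measurable_coord i) measurable_snd).
by apply/funext => z; rewrite !mxE.
Qed.

End slope.

(** * The space X^s *)

Section product_ae.
Context d1 d2 (T1 : measurableType d1) (T2 : measurableType d2) (R : realType).
Variables (m1 : {sigma_finite_measure set T1 -> \bar R})
  (m2 : {sigma_finite_measure set T2 -> \bar R}).
Local Open Scope ereal_scope.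

(** The exceptional set lies in two strips, each null even if its other side has infinite measure,
    as [0 * +oo = 0]. *)
Lemma ae_prod (P : T1 -> Prop) (Q : T2 -> Prop) :
  {ae m1, forall x, P x} -> {ae m2, forall x, Q x} ->
  {ae (m1 \x m2), forall z, P z.1 /\ Q z.2}.
Proof.
move=> [A [mA A0 PA]] [B [mB B0 QB]].
apply: (@negligibleS _ _ _ _ ((A `*` setT) `|` (setT `*` B))).
  move=> [x y] /= /not_andP[nP|nQ]; [left|right]; split=> //.
    exact: PA.
  exact: QB.
apply: negligibleU; apply/negligibleP; try exact: measurableX.
  rewrite /= product_measure1E//; rewrite -[RHS](mul0e (m2 setT)).
  by congr (_ * _); exact: A0.
rewrite /= product_measure1E// -[RHS](mule0 (m1 setT)).
by congr (_ * _); exact: B0.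
Qed.

End product_ae.

Section Xs_space.
Context {R : realType} {N : nat}.
Variables (s : R) (Omega : set 'rV[R]_N).
Hypothesis mO : measurable Omega.
Local Notation mu := (@lebesgue_rV R N).
Local Notation X := (Xs s Omega).
Implicit Types u v w : 'rV[R]_N -> R.

Definition mass u v : R := \int[mu]_(x in Omega) (u x * v x).

Lemma XsP u : X u <-> [/\ u \in Lfun mu 2%:E,
  slope s u \in Lfun (mu \x mu)%E 2%:E &
  {ae mu, forall x, ~ Omega x -> u x = 0}].
Proof.
have GE : (fun z => (gagliardo_integrand s u u z)%:E) =
    (fun z => (slope s u z ^+ 2)%:E).
  by apply/funext => z; rewrite gagliardo_slope.
split=> -[uL uG u0]; split=> //.
  apply/Lfun2P; split; first exact: measurable_slope (Lfun2_measurable uL).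
  by rewrite -GE.
by move/Lfun2P : uG => [_]; rewrite -GE.
Qed.

Lemma Xs_Lfun u : X u -> u \in Lfun mu 2%:E.
Proof. by case. Qed.

Lemma Xs_slope u : X u -> slope s u \in Lfun (mu \x mu)%E 2%:E.
Proof. by case/XsP. Qed.

Lemma Xs_sub : is_subspace X.
Proof.
split=> [|c u v /XsP[uL uG u0] /XsP[vL vG v0]]; apply/XsP; split.
- exact: Lfun2_0.
- rewrite (_ : slope s 0 = 0); first exact: Lfun2_0.
  by apply/funext => z; rewrite /slope subrr mul0r.
- exact: aeW.
- exact: Lfun2_lin.
- by rewrite slope_lin; exact: Lfun2_lin.
- apply: filterS2 u0 v0 => x u0 v0 Ox.
  have -> : (c *: u + v) x = c * u x + v x by [].
  by rewrite u0// v0// mulr0 addr0.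
Qed.

Lemma ipE u v : ip s u v = \int[(mu \x mu)%E]_z (slope s u z * slope s v z).
Proof. by apply: eq_Rintegral => z _; exact: gagliardo_slope. Qed.

Lemma ip_form : sym_form X (ip s).
Proof.
split=> [u v|w Xw c u v Xu Xv].
  by rewrite !ipE; apply: eq_Rintegral => z _; rewrite mulrC.
rewrite !ipE slope_lin RintegralM_lin//; exact: Xs_slope.
Qed.

Lemma mass_form : sym_form X mass.
Proof.
split=> [u v|w Xw c u v Xu Xv].
  by apply: eq_Rintegral => z _; rewrite mulrC.
rewrite /mass RintegralM_lin//; exact: Xs_Lfun.
Qed.

Lemma ip_ge0 u : X u -> 0 <= ip s u u.
Proof.
by move=> _; rewrite ipE; apply: Rintegral_ge0 => z _; rewrite -expr2 sqr_ge0.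
Qed.

Lemma mass_ge0 u : X u -> 0 <= mass u u.
Proof. by move=> _; apply: Rintegral_ge0 => z _; rewrite -expr2 sqr_ge0. Qed.

Lemma ip_sqE u : X u -> (ip s u u)%:E = (\int[(mu \x mu)%E]_z (slope s u z ^+ 2)%:E)%E.
Proof. by move=> Xu; rewrite ipE Rintegral_sqE//; exact: Xs_slope. Qed.

(** Elements of X^s vanish almost everywhere off [Omega], so the integral extends to the whole
    space. *)
Lemma mass_sqE u : X u -> (mass u u)%:E = (\int[mu]_x (u x ^+ 2)%:E)%E.
Proof.
move=> Xu; have uL := Xs_Lfun Xu; have mu_ := Lfun2_measurable uL.
have -> : (mass u u)%:E = (\int[mu]_(x in Omega) (u x ^+ 2)%:E)%E.
  by rewrite fineK//; exact/integrable_fin_num/Lfun2_integrableM.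
rewrite integral_mkcond; apply: ge0_ae_eq_integral => //.
- apply/(measurable_restrictT _ mO)/measurable_funTS/measurable_EFinP.
  exact: measurable_funX.
- by apply/measurable_EFinP; exact: measurable_funX.
- by move=> x _; rewrite patchE; case: ifPn => // _; rewrite lee_fin sqr_ge0.
- by move=> x _; rewrite lee_fin sqr_ge0.
case/XsP: Xu => _ _; apply: filterS => x u0 _; rewrite patchE.
by case: ifPn => //; rewrite notin_setE => /u0 ->; rewrite expr0n.
Qed.

(** The L^2 bound yields an almost everywhere limit [p]; Fatou for the functions and for their
    slopes bounds each form by [16^-n], whence the factor 2. *)
Lemma Xs_complete (u : nat -> 'rV[R]_N -> R) : (forall n, X (u n)) ->
  (forall n m, (n <= m)%N -> ip s (u m - u n) (u m - u n) +
     mass (u m - u n) (u m - u n) <= 16%:R^-1 ^+ n) ->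
  exists2 p, X p & forall n, ip s (u n - p) (u n - p) +
     mass (u n - p) (u n - p) <= 2 * 16%:R^-1 ^+ n.
Proof.
move=> Xu cu; have XB n m : X (u m - u n) by apply: (subspaceB Xs_sub).
have mun n : measurable_fun setT (u n) by exact/Lfun2_measurable/Xs_Lfun.
have cip n m : (n <= m)%N -> ip s (u m - u n) (u m - u n) <= 16%:R^-1 ^+ n.
  by move=> nm; apply: le_trans (cu _ _ nm); rewrite lerDl mass_ge0.
have cmass n m : (n <= m)%N -> mass (u m - u n) (u m - u n) <= 16%:R^-1 ^+ n.
  by move=> nm; apply: le_trans (cu _ _ nm); rewrite lerDr ip_ge0.
have cmass' n m : (n <= m)%N ->
    (\int[mu]_x ((u m x - u n x) ^+ 2)%:E <= (16%:R^-1 ^+ n)%:E)%E.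
  by move=> nm; have := cmass _ _ nm; rewrite -lee_fin mass_sqE.
have cvgu : {ae mu, forall x, cvgn (u ^~ x)}.
  by apply: L2_fast_cauchy_ae_cvg => // n; exact: cmass'.
(* The upper limit is measurable on the whole space and equals the limit wherever the sequence
   converges. *)
pose p x := fine (limn_esup (fun n => (u n x)%:E)).
have mp : measurable_fun setT p.
  apply: (measurableT_comp (fine_measurable measurableT)).
  by apply: measurable_fun_limn_esup => n; apply/measurable_EFinP.
have pE x : cvgn (u ^~ x) -> u n x @[n --> \oo] --> p x.
  move=> ux; have : (u n x)%:E @[n --> \oo] --> (limn (u ^~ x))%:E.
    by apply: cvg_EFin => //; exact: nearW.
  by move=> /cvg_limn_einf_sup[_ lE]; rewrite /p lE.
have up : {ae mu, forall x, u n x @[n --> \oo] --> p x}.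
  by apply: filterS cvgu => x; exact: pE.
have massp n : (\int[mu]_x ((u n x - p x) ^+ 2)%:E <= (16%:R^-1 ^+ n)%:E)%E.
  by apply: L2_fatou => // m; exact: cmass'.
have ipp n : (\int[(mu \x mu)%E]_z ((slope s (u n) z - slope s p z) ^+ 2)%:E
    <= (16%:R^-1 ^+ n)%:E)%E.
  apply: (@L2_fatou _ _ _ _ (fun m => slope s (u m)) (slope s p)) => [m|||m nm].
  - exact: measurable_slope.
  - exact: measurable_slope.
  - apply: filterS (ae_prod up up) => z [u1 u2].
    exact: (cvgM (cvgB u1 u2) (cvg_cst _)).
  have := cip _ _ nm; rewrite -lee_fin ip_sqE//.
  by rewrite slopeB.
have Lun : u 0%N - p \in Lfun mu 2%:E.
  apply/Lfun2P; split; first exact: measurable_funB.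
  exact: le_lt_trans (massp 0%N) (ltry _).
have Lsun : slope s (u 0%N) - slope s p \in Lfun (mu \x mu)%E 2%:E.
  apply/Lfun2P; split; first by apply: measurable_funB; exact: measurable_slope.
  exact: le_lt_trans (ipp 0%N) (ltry _).
have Xp : X p.
  apply/XsP; split.
  - by rewrite -(subKr (u 0%N) p); apply: Lfun2B => //; exact: Xs_Lfun.
  - rewrite -(subKr (slope s (u 0%N)) (slope s p)); apply: Lfun2B => //.
    exact: Xs_slope.
  - have u0 : {ae mu, forall x, forall n, ~ Omega x -> u n x = 0}.
      by apply: ae_foralln => n; case/XsP: (Xu n).
    apply: filterS2 up u0 => x ux ux0 Ox.
    apply/esym/(cvg_unique _ _ ux) => //.
    rewrite (_ : (fun n => u n x) = cst 0)//; first exact: cvg_cst.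
    by apply/funext => n; exact: ux0.
exists p => // n; have Xd : X (u n - p) by apply: (subspaceB Xs_sub).
rewrite mulr_natl mulr2n; apply: lerD.
  by have := ipp n; rewrite -lee_fin ip_sqE// slopeB.
by have := massp n; rewrite -lee_fin mass_sqE.
Qed.

End Xs_space.

(** * Averages on cubes and compactness *)

Section variance.
Context d (T : measurableType d) (R : realType).
Variable mu : {sigma_finite_measure set T -> \bar R}.
Variables (q : set T) (V : R).
Hypotheses (mq : measurable q) (muq : mu q = V%:E).
Implicit Types u : T -> R.

Definition l2 (f g : T -> R) := \int[mu]_x (f x * g x).

Lemma l2_form : sym_form [set f | f \in Lfun mu 2%:E] l2.
Proof.
split=> [u v|w Xw c u v Xu Xv].
  by apply: eq_Rintegral => z _; rewrite mulrC.
by rewrite /l2 RintegralM_lin.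
Qed.

Lemma Lfun2_is_subspace : is_subspace [set f : T -> R | f \in Lfun mu 2%:E].
Proof. by split=> [|c u v Xu Xv]; [exact: Lfun2_0|exact: Lfun2_lin]. Qed.

Definition cut u : T -> R := fun x => u x * \1_q x.

Lemma indic_sq x : \1_q x * \1_q x = \1_q x :> R.
Proof. by rewrite !indicE; case: (x \in q); rewrite ?mulr1 ?mulr0. Qed.

Lemma integral_indic_sq : (\int[mu]_x (\1_q x * \1_q x)%:E = V%:E)%E.
Proof.
under eq_integral do rewrite indic_sq.
by rewrite integral_indic// setIT; exact: muq.
Qed.

Lemma indic_Lfun2 : (\1_q : T -> R) \in Lfun mu 2%:E.
Proof.
by apply/Lfun2P; split=> //; rewrite integral_indic_sq ltry.
Qed.

Lemma l2_indic : l2 \1_q \1_q = V.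
Proof. by rewrite /l2 /Rintegral integral_indic_sq. Qed.

Lemma cut_Lfun2 u : u \in Lfun mu 2%:E -> cut u \in Lfun mu 2%:E.
Proof.
move=> uL; apply: (Lfun2_le _ _ uL); last first.
  move=> x; rewrite /cut normrM ler_piMr//.
  by rewrite indicE; case: (_ \in _); rewrite ?normr1 ?normr0.
apply: measurable_funM; first exact: (Lfun2_measurable uL). exact: measurable_indic.
Qed.

(** The double integral of [(u x - u y)^2] over [q x q] is twice the volume times the integral of
    [u^2] minus the squared integral of [u], by Tonelli. *)
Lemma variance_double_integral u : u \in Lfun mu 2%:E ->
  (\int[(mu \x mu)%E]_z ((u z.1 - u z.2) ^+ 2 * \1_q z.1 * \1_q z.2)%:E =
   (2 * (V * l2 (cut u) (cut u) - l2 (cut u) \1_q ^+ 2))%:E)%E.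
Proof.
move=> uL; have mu_ := Lfun2_measurable uL.
have wL := cut_Lfun2 uL; have eL := indic_Lfun2.
have me : measurable_fun setT (\1_q : T -> R) by exact: measurable_indic.
rewrite fubini_tonelli1//; last 2 first.
- apply/measurable_EFinP; apply: measurable_funM.
    apply: measurable_funM.
      apply: measurable_funX; apply: measurable_funB.
        exact: (measurableT_comp mu_ measurable_fst).
      exact: (measurableT_comp mu_ measurable_snd).
    exact: (measurableT_comp me measurable_fst).
  exact: (measurableT_comp me measurable_snd).
- by move=> z; rewrite lee_fin mulr_ge0// mulr_ge0// sqr_ge0.
set w := cut u; set e : T -> R := \1_q; set c := l2 w e; set m := l2 w w.
(* For fixed [x] in [q] the inner integral is [V * u x ^+ 2 - 2 * c * u x + m]; it is arranged as
   products of L^2 functions for the outer integration. *)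
have FE x : fubini_F mu (fun z => ((u z.1 - u z.2) ^+ 2 * e z.1 * e z.2)%:E) x
   = ((V *: w + (- (2 * c)) *: e) x * w x + m * (e x * e x))%:E.
  have fL : u x *: e - w \in Lfun mu 2%:E.
    by apply: Lfun2B => //; exact: (subspaceZ _ Lfun2_is_subspace).
  rewrite /fubini_F.
  transitivity (\int[mu]_y ((e x)%:E * (((u x *: e - w) y) ^+ 2)%:E))%E.
    apply: eq_integral => y _; rewrite -EFinM; congr (_%:E) => /=.
    have -> : (u x *: e - w) y = u x * e y - u y * e y by [].
    by rewrite -mulrBl exprMn [e y ^+ 2]expr2 indic_sq; ring.
  rewrite ge0_integralZl//; last 3 first.
  - apply/measurable_EFinP/measurable_funX; exact: (Lfun2_measurable fL).
  - by move=> y _; rewrite lee_fin sqr_ge0.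
  - by rewrite lee_fin.
  rewrite -Rintegral_sqE// -EFinM; congr (_%:E).
  have -> : \int[mu]_y ((u x *: e - w) y * (u x *: e - w) y) =
      u x ^+ 2 * V - 2 * (u x * c) + m.
    have ueL : u x *: e \in Lfun mu 2%:E by exact: (subspaceZ _ Lfun2_is_subspace).
    rewrite -[LHS]/(l2 _ _) (formBB Lfun2_is_subspace l2_form)//.
    rewrite (formZZ Lfun2_is_subspace l2_form)// l2_indic.
    rewrite (formZl Lfun2_is_subspace l2_form)//.
    by rewrite (formC l2_form e).
  have -> : (V *: w + (- (2 * c)) *: e) x = V * (u x * e x) - 2 * c * e x.
    have -> : (V *: w + - (2 * c) *: e) x = V * w x + (- (2 * c)) * e x by [].
    by rewrite mulNr.
  have := indic_sq x; rewrite -/e => ee.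
  have -> : w x = u x * e x by [].
  by rewrite -{1}ee; ring.
under eq_integral do rewrite FE.
have VL : V *: w + - (2 * c) *: e \in Lfun mu 2%:E.
  by apply: Lfun2_lin => //; exact: (subspaceZ _ Lfun2_is_subspace).
have i1 : mu.-integrable setT (EFin \o (fun x => (V *: w + (- (2 * c)) *: e) x * w x)).
  exact: Lfun2_integrableM.
have i2 : mu.-integrable setT (EFin \o (fun x => e x * e x)).
  exact: Lfun2_integrableM.
have i3 : mu.-integrable setT (EFin \o (fun x => m * (e x * e x))).
  by apply: (@eq_integrable _ _ _ mu _ measurableT
    (fun x => m%:E * (e x * e x)%:E)%E) => //; exact: integrableZl.
transitivity (\int[mu]_x ((V *: w + (- (2 * c)) *: e) x * w x + m * (e x * e x)))%:E.
  rewrite fineK//; apply: integrable_fin_num => //.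
  exact: (integrableD _ i1 i3).
congr (_%:E); rewrite RintegralD// RintegralZl//.
rewrite -[X in _ + _ * X]/(l2 e e) l2_indic.
rewrite RintegralM_lin//; last exact: (subspaceZ _ Lfun2_is_subspace).
rewrite -/(l2 w w) -/m.
have -> : \int[mu]_x ((- (2 * c) *: e) x * w x) = - (2 * c) * c.
  rewrite -[LHS]/(l2 _ _) (formZl Lfun2_is_subspace l2_form)//.
  by rewrite (formC l2_form e).
by ring.
Qed.

End variance.

(** * A grid of cubes *)

Section cubes.
Context {R : realType} {N : nat}.
Local Notation mu := (@lebesgue_rV R N).

(** Half-open, so that distinct cubes of the grid are disjoint. *)
Definition side m (r h : R) (j : 'I_m) : set (measurableTypeR R) :=
  [set` `[h * j%:R - r, h * j.+1%:R - r[%R].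

Definition cube m (r h : R) (f : {ffun 'I_N -> 'I_m}) : set 'rV[R]_N :=
  [set x | forall i, side r h (f i) (x ord0 i)].

Lemma measurable_cube m r h (f : {ffun 'I_N -> 'I_m}) : measurable (cube r h f).
Proof.
apply: (@measurable_rV_box _ _ (fun i => side r h (f i))) => i.
exact: measurable_itv.
Qed.

Lemma cube_measure m r h (f : {ffun 'I_N -> 'I_m}) : 0 < h ->
  mu (cube r h f) = (h ^+ N)%:E.
Proof.
move=> h0; rewrite /cube (lebesgue_rV_box (A := fun i => side r h (f i))).
  transitivity (\prod_(i < N) h%:E)%E.
    apply: eq_bigr => i _; rewrite /side lebesgue_measure_itv/= lte_fin.
    rewrite -natr1 mulrDr mulr1 ifT; last by rewrite ltrD2r ltrDl.
    by rewrite -EFinB; congr (_%:E); ring.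
  by rewrite prodEFin prodr_const card_ord.
by move=> i; exact: measurable_itv.
Qed.

Lemma cube_inj m r h (f g : {ffun 'I_N -> 'I_m}) x : 0 < h ->
  cube r h f x -> cube r h g x -> f = g.
Proof.
move=> h0 fx gx; apply/ffunP => i; apply/val_inj/eqP => /=.
have := fx i; have := gx i; rewrite /side/= !in_itv/=.
move=> /andP[g1 g2] /andP[f1 f2]; rewrite eqn_leq.
apply/andP; split; rewrite -ltnS -(ltr_nat R) -(ltr_pM2l h0).
  by rewrite -(ltrD2r (- r)) (le_lt_trans f1).
by rewrite -(ltrD2r (- r)) (le_lt_trans g1).
Qed.

Lemma cube_cover m (r : R) (x : 'rV[R]_N) : 0 < r ->
  (forall i, `|x ord0 i| < r) ->
  exists f : {ffun 'I_N -> 'I_m.+1}, cube r (2 * r / m.+1%:R) f x.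
Proof.
move=> r0 xr; set h := 2 * r / m.+1%:R.
have h0 : 0 < h by rewrite divr_gt0// mulr_gt0.
have hm : h * m.+1%:R = 2 * r by rewrite /h mulfVK.
(* The index is the integer part of [(x_i + r) / h], which is below [m + 1] because
   [h * (m + 1) = 2 * r]. *)
have tm i : (Num.truncn ((x ord0 i + r) / h) < m.+1)%N.
  have := xr i; rewrite ltr_norml => /andP[x1 x2].
  rewrite truncn_lt_nat ?ler_pdivlMr ?mul0r//; last lra.
  by rewrite ltr_pdivrMr// mulrC hm; lra.
exists [ffun i => Ordinal (tm i)] => i; rewrite /side/= in_itv/= ffunE/=.
have := xr i; rewrite ltr_norml => /andP[x1 x2].
have t0 : 0 <= (x ord0 i + r) / h by rewrite divr_ge0 ?(ltW h0)//; lra.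
have /andP[] := truncn_itv t0.
rewrite ler_pdivlMr// ltr_pdivrMr//.
by set a := _%:R; set b := _.+1%:R => ab ba; apply/andP; split; lra.
Qed.

Lemma cube_diam m r h (f : {ffun 'I_N -> 'I_m}) x y : 0 < h ->
  cube r h f x -> cube r h f y -> enorm (x - y) <= Num.sqrt N%:R * h.
Proof.
move=> h0 fx fy; rewrite /enorm -[h in leRHS]ger0_norm ?(ltW h0)// -sqrtr_sqr.
rewrite -sqrtrM ?ler0n// ler_wsqrtr// /dotp.
have -> : N%:R * h ^+ 2 = \sum_(i < N) h ^+ 2 by rewrite sumr_const card_ord mulr_natl.
apply: ler_sum => i _; rewrite !mxE -expr2.
have := fx i; have := fy i; rewrite /side/= !in_itv/= -natr1 => /andP[? ?] /andP[? ?].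
rewrite -real_normK ?num_real// lerXn2r ?nnegrE ?(ltW h0)//.
by rewrite ler_norml; apply/andP; split; lra.
Qed.

Lemma enorm_ge0 (x : 'rV[R]_N) : 0 <= enorm x.
Proof. exact: sqrtr_ge0. Qed.

Lemma enorm_eq0 (x : 'rV[R]_N) : enorm x = 0 -> x = 0.
Proof.
move=> /eqP; rewrite sqrtr_eq0 => x0; apply/rowP => i; rewrite mxE.
have : dotp x x = 0.
  apply/eqP; rewrite eq_le x0; apply: sumr_ge0 => j _.
  by rewrite -expr2 sqr_ge0.
move=> /eqP; rewrite psumr_eq0; last by move=> j _; rewrite -expr2 sqr_ge0.
by move=> /allP/(_ i); rewrite mem_index_enum -expr2 sqrf_eq0 => /(_ isT)/eqP.
Qed.

(** At distance at most [D], the factor [D^(N + 2 s)] compensates the singular weight; on the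
    diagonal both sides are 0. *)
Lemma diff_le_slope s (u : 'rV[R]_N -> R) z D : 0 <= N%:R + 2 * s ->
  enorm (z.1 - z.2) <= D ->
  (u z.1 - u z.2) ^+ 2 <= D `^ (N%:R + 2 * s) * slope s u z ^+ 2.
Proof.
move=> p0 zD; rewrite [slope s u z ^+ 2]expr2 -gagliardo_slope.
rewrite /gagliardo_integrand -expr2.
have [z0|z0] := eqVneq (enorm (z.1 - z.2)) 0.
  have /eqP := enorm_eq0 z0; rewrite subr_eq0 => /eqP ->.
  by rewrite subrr expr0n mul0r mulr0.
have zp : 0 < enorm (z.1 - z.2) `^ (N%:R + 2 * s).
  by rewrite powR_gt0// lt_def z0 enorm_ge0.
rewrite mulrA ler_pdivlMr// mulrC ler_wpM2r ?sqr_ge0//.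
by rewrite ge0_ler_powR// nnegrE ?enorm_ge0// (le_trans (enorm_ge0 _) zD).
Qed.

End cubes.

(** * Compactness of X^s in L^2 *)

Section compactness.
Context {R : realType} {N : nat}.
Variables (s : R) (Omega : set 'rV[R]_N).
Hypotheses (mO : measurable Omega) (bO : bounded_set Omega) (s_gt0 : 0 < s).
Local Notation mu := (@lebesgue_rV R N).
Local Notation X := (Xs s Omega).

Lemma Omega_box : exists2 r : R, 0 < r &
  forall x, Omega x -> forall i, `|x ord0 i| < r.
Proof.
have [M [Mr MO]] := bO.
exists (`|M| + 2); first by rewrite ltr_wpDl.
move=> x Ox i; have Mx : `|x| <= `|M| + 1.
  by apply: (MO (`|M| + 1)) => //; rewrite (le_lt_trans (ler_norm M))// ltrDl.
have : ball (0 : 'rV[R]_N) (`|M| + 2) x.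
  rewrite mx_norm_ball /ball_/= sub0r normrN (le_lt_trans Mx)// ltrD2l; lra.
by case=> _ /(_ ord0 i); rewrite /ball/= mxE sub0r normrN.
Qed.

(** By disjointness at most one cube contains both points, so at most one term is nonzero. *)
Lemma sum_cubes_le m r h (x y : 'rV[R]_N) (t b : R) : 0 < h -> 0 <= b ->
  (forall f : {ffun 'I_N -> 'I_m}, cube r h f x -> cube r h f y -> t <= b) ->
  \sum_(f : {ffun 'I_N -> 'I_m}) t * \1_(cube r h f) x * \1_(cube r h f) y <= b.
Proof.
move=> h0 b0 tb.
have [[f [fx fy]]|nf] := pselect (exists f : {ffun 'I_N -> 'I_m},
    cube r h f x /\ cube r h f y).
  rewrite (bigD1 f)//= big1 ?addr0; last first.
    move=> g gf; rewrite !indicE (_ : x \in _ = false) ?mulr0 ?mul0r//.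
    apply: memNset => gx.
    by move: gf; rewrite (cube_inj h0 gx fx) eqxx.
  by rewrite !indicE !mem_set// !mulr1; exact: tb fx fy.
rewrite big1// => f _; rewrite !indicE.
have [fx|fx] := pselect (cube r h f x); last by rewrite memNset ?mulr0 ?mul0r.
have [fy|fy] := pselect (cube r h f y); last by rewrite [y \in _]memNset ?mulr0.
by case: nf; exists f.
Qed.

Let p := N%:R + 2 * s : R.

Let p_ge0 : 0 <= p.
Proof. by rewrite addr_ge0// mulr_ge0// ltW. Qed.

(** The powers [h^N] cancel and leave a constant times [h^(2 s)], which tends to 0 with the mesh
    [h]. *)
Lemma small_mesh (r e : R) : 0 < r -> 0 < e -> exists m,
  (2 * (2 * r / m.+1%:R) ^+ N)^-1 * (Num.sqrt N%:R * (2 * r / m.+1%:R)) `^ p <= e.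
Proof.
move=> r0 e0; pose a : R := Num.sqrt N%:R `^ p.
have a0 : 0 <= a by exact: powR_ge0.
(* The solution of [d^(2 s) = e / (a + 1)]; the 1 keeps the denominator positive if [a = 0]. *)
pose d := (e / (a + 1)) `^ (2 * s)^-1.
have ea : 0 < e / (a + 1) by rewrite divr_gt0// ltr_wpDl.
have d0 : 0 < d by exact: powR_gt0.
have /ltr_add_invr[m] : 0 < d / (2 * r) by rewrite divr_gt0// mulr_gt0.
rewrite add0r ltr_pdivlMr ?mulr_gt0// mulrC => hd; exists m.
set h := 2 * r / m.+1%:R in hd *.
have h0 : 0 < h by rewrite divr_gt0// mulr_gt0.
have hs : h `^ (2 * s) <= e / (a + 1).
  have -> : e / (a + 1) = d `^ (2 * s).
    by rewrite -powRrM mulVf ?powRr1 ?(ltW ea)// gt_eqF// mulr_gt0.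
  by rewrite ge0_ler_powR ?nnegrE ?(ltW h0) ?(ltW hd) ?(ltW d0)// mulr_ge0// ltW.
rewrite powRM ?sqrtr_ge0 ?(ltW h0)// -/a /p powRD; last by rewrite (gt_eqF h0) implybT.
rewrite powR_mulrn ?(ltW h0)//.
have hN : 0 < h ^+ N by exact: exprn_gt0.
have -> : (2 * h ^+ N)^-1 * (a * (h ^+ N * h `^ (2 * s))) = a * h `^ (2 * s) / 2.
  by field; rewrite gt_eqF.
have : a * h `^ (2 * s) <= a * (e / (a + 1)) by rewrite ler_wpM2l.
have : a * (e / (a + 1)) <= e.
  by rewrite mulrA ler_pdivrMr; [rewrite mulrC ler_wpM2l; lra|lra].
have := powR_ge0 h (2 * s); nra.
Qed.

(** The functionals are the integrals over the cubes divided by [sqrt V]. What remains of the mass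
    is oscillation inside cubes, bounded by the Gagliardo form times the factor of [small_mesh]. *)
Lemma Xs_compact (e : R) : 0 < e ->
  exists (I : finType) (l : I -> ('rV[R]_N -> R) -> R) (K : R),
  [/\ forall i, linear_on X (l i),
      forall i u, X u -> l i u ^+ 2 <= K * mass Omega u u &
      forall u, X u -> mass Omega u u <= e * ip s u u + \sum_i l i u ^+ 2].
Proof.
move=> e0; have [r r0 Or] := Omega_box.
have [m] := small_mesh r0 e0; set h := 2 * r / m.+1%:R.
have h0 : 0 < h by rewrite divr_gt0// mulr_gt0.
set D := Num.sqrt N%:R * h => hD.
set V := h ^+ N in hD; have V0 : 0 < V by exact: exprn_gt0.
pose I := {ffun 'I_N -> 'I_m.+1}.
pose q (f : I) := cube r h f.
have mq f : measurable (q f) by exact: measurable_cube.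
have muq f : mu (q f) = V%:E by exact: cube_measure.
pose c f u := l2 mu (cut (q f) u) \1_(q f).
pose v f u := l2 mu (cut (q f) u) (cut (q f) u).
have cutL f u : X u -> cut (q f) u \in Lfun mu 2%:E.
  by move=> Xu; apply: cut_Lfun2 => //; exact: Xs_Lfun Xu.
have sqV : (Num.sqrt V) ^+ 2 = V by rewrite sqr_sqrtr// ltW.
pose F f u (z : 'rV[R]_N * 'rV[R]_N) : R :=
  (u z.1 - u z.2) ^+ 2 * \1_(q f) z.1 * \1_(q f) z.2.
have FE f u : X u ->
    (\int[(mu \x mu)%E]_z (F f u z)%:E = (2 * (V * v f u - c f u ^+ 2))%:E)%E.
  by move=> Xu; apply: variance_double_integral => //; exact: Xs_Lfun Xu.
have F0 f u z : 0 <= F f u z by rewrite mulr_ge0// mulr_ge0// sqr_ge0.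
(* Cauchy-Schwarz on the cube, read off from the sign of the double integral. *)
have cv f u : X u -> c f u ^+ 2 <= V * v f u.
  move=> Xu; have : (0 <= (2 * (V * v f u - c f u ^+ 2))%:E)%E.
    by rewrite -FE//; apply: integral_ge0 => z _; rewrite lee_fin.
  by rewrite lee_fin; lra.
have vE f u : X u -> (v f u)%:E = (\int[mu]_x (cut (q f) u x ^+ 2)%:E)%E.
  by move=> Xu; rewrite Rintegral_sqE//; exact: cutL.
have mcut f u : X u -> measurable_fun setT (fun x => (cut (q f) u x ^+ 2)%:E).
  move=> Xu; apply/measurable_EFinP/measurable_funX.
  exact: (Lfun2_measurable (cutL f u Xu)).
have cut_le f u x : cut (q f) u x ^+ 2 <= u x ^+ 2.
  rewrite /cut exprMn indicE; case: (_ \in _); rewrite ?expr1n ?mulr1//.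
  by rewrite expr0n mulr0 sqr_ge0.
have v_le f u : X u -> v f u <= mass Omega u u.
  move=> Xu; have mu_ := Lfun2_measurable (Xs_Lfun Xu).
  rewrite -lee_fin vE// (mass_sqE mO Xu).
  apply: ge0_le_integral => //.
  - by move=> x _; rewrite lee_fin sqr_ge0.
  - exact: mcut.
  - by apply/measurable_EFinP; exact: measurable_funX.
  - by move=> x _; rewrite lee_fin cut_le.
exists I, (fun f u => c f u / Num.sqrt V), 1; split.
- move=> f t u w Xu Xw; rewrite /c.
  have -> : cut (q f) (t *: u + w) = t *: cut (q f) u + cut (q f) w.
    apply/funext => x; rewrite /cut.
    have -> : (t *: u + w) x = t * u x + w x by [].
    by rewrite mulrDl -mulrA.
  have := form_lin (l2_form mu) (indic_Lfun2 (mq f) (muq f)).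
  move=> ->; [|exact: cutL|exact: cutL].
  by rewrite mulrDl mulrA.
- move=> f u Xu; rewrite mul1r expr_div_n sqV ler_pdivrMr// mulrC.
  by rewrite (le_trans (cv f u Xu))// ler_pM2l// v_le.
move=> u Xu; have mu_ := Lfun2_measurable (Xs_Lfun Xu).
have mass_le : mass Omega u u <= \sum_f v f u.
  have S0 x : (0 <= \sum_f (cut (q f) u x ^+ 2)%:E)%E.
    by apply: sume_ge0 => f _; rewrite lee_fin sqr_ge0.
  have mS : measurable_fun setT (fun x => \sum_f (cut (q f) u x ^+ 2)%:E)%E.
    by apply: emeasurable_sum => f; exact: mcut.
  have -> : mass Omega u u = fine (\int[mu]_(x in Omega) (u x ^+ 2)%:E)%E by [].
  rewrite -lee_fin fineK; last first.
    by apply/integrable_fin_num/Lfun2_integrableM => //; exact: Xs_Lfun Xu.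
  apply: (@le_trans _ _ (\int[mu]_(x in Omega) \sum_f (cut (q f) u x ^+ 2)%:E)%E).
    apply: ge0_le_integral => //.
    - by move=> x _; rewrite lee_fin sqr_ge0.
    - by apply/measurable_funTS/measurable_EFinP; exact: measurable_funX.
    - exact: measurable_funTS.
    move=> x Ox; have [f fx] := cube_cover m r0 (Or x Ox).
    rewrite sumEFin lee_fin (bigD1 f)//= {1}/cut indicE mem_set// mulr1 lerDl.
    by apply: sumr_ge0 => g _; exact: sqr_ge0.
  apply: (@le_trans _ _ (\int[mu]_x \sum_f (cut (q f) u x ^+ 2)%:E)%E).
    by apply: ge0_subset_integral.
  rewrite ge0_integral_sum//; last 2 first.
  - by move=> f; exact: mcut.
  - by move=> f x _; rewrite lee_fin sqr_ge0.
  by rewrite -sumEFin; apply: lee_sum => f _; rewrite vE.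
have var_le : \sum_f (2 * (V * v f u - c f u ^+ 2)) <= D `^ p * ip s u u.
  have mslope := measurable_slope s mu_.
  rewrite -lee_fin -sumEFin EFinM (ip_sqE Xu).
  rewrite -ge0_integralZl//; last 3 first.
  - by apply/measurable_EFinP; exact: measurable_funX.
  - by move=> z _; rewrite lee_fin sqr_ge0.
  - by rewrite lee_fin powR_ge0.
  under eq_bigr do rewrite -FE//.
  have mF f : measurable_fun setT (fun z => (F f u z)%:E).
    have mi : measurable_fun setT (\1_(q f) : 'rV[R]_N -> R).
      exact: measurable_indic.
    apply/measurable_EFinP; apply: measurable_funM.
      apply: measurable_funM.
        apply: measurable_funX; apply: measurable_funB.
          exact: (measurableT_comp mu_ measurable_fst).
        exact: (measurableT_comp mu_ measurable_snd).
      exact: (measurableT_comp mi measurable_fst).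
    exact: (measurableT_comp mi measurable_snd).
  rewrite -ge0_integral_sum//; last by move=> f z _; rewrite lee_fin.
  apply: ge0_le_integral => //.
  - by move=> z _; apply: sume_ge0 => f _; rewrite lee_fin.
  - exact: emeasurable_sum.
  - apply: emeasurable_funM => //.
    by apply/measurable_EFinP; exact: measurable_funX.
  move=> z _; rewrite sumEFin -EFinM lee_fin; apply: sum_cubes_le => //.
    by rewrite mulr_ge0 ?powR_ge0 ?sqr_ge0.
  by move=> f f1 f2; apply: diff_le_slope => //; exact: cube_diam f1 f2.
apply: (le_trans mass_le).
(* The variance identity solved for [v f u] and summed over the cubes. *)
have -> : \sum_f v f u = (2 * V)^-1 * \sum_f (2 * (V * v f u - c f u ^+ 2)) +
    \sum_f (c f u / Num.sqrt V) ^+ 2.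
  rewrite mulr_sumr -big_split; apply: eq_bigr => f _ /=.
  by rewrite expr_div_n sqV; field; rewrite gt_eqF.
rewrite lerD2r; apply: le_trans (_ : (2 * V)^-1 * (D `^ p * ip s u u) <= _).
  by rewrite ler_pM2l// invr_gt0 mulr_gt0.
by rewrite mulrA ler_wpM2r// (ip_ge0 Xu).
Qed.

End compactness.

(** * The energy near resonance *)

Section energy.
Context {R : realType} {N : nat}.
Variables (s : R) (Omega : set 'rV[R]_N).
Hypothesis mO : measurable Omega.
Local Notation mu := (@lebesgue_rV R N).
Local Notation X := (Xs s Omega).
Local Notation A := (ip s).
Local Notation B := (mass Omega).
Implicit Types u v w : 'rV[R]_N -> R.

(** Since [u |u|] is [(u^+)^2 - (u^-)^2], this is [|u^+|^2 - |u^-|^2] in L^2 norms, the functional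
    [S]. *)
Definition smass u : R := \int[mu]_(x in Omega) (u x * `|u x|).

Lemma Xs_norm_Lfun u : X u -> (fun x => `|u x|) \in Lfun mu 2%:E.
Proof.
move=> Xu; have uL := Xs_Lfun Xu; apply: (Lfun2_le _ _ uL).
  exact: (measurableT_comp _ (Lfun2_measurable uL)).
by move=> x; rewrite normr_id.
Qed.

Lemma smass_integrable u : X u ->
  mu.-integrable Omega (EFin \o (fun x => u x * `|u x|)).
Proof.
by move=> Xu; apply: Lfun2_integrableM => //; [exact: Xs_Lfun Xu|exact: Xs_norm_Lfun].
Qed.

Lemma mass_integrable u : X u ->
  mu.-integrable Omega (EFin \o (fun x => u x * u x)).
Proof. by move=> Xu; apply: Lfun2_integrableM => //; exact: Xs_Lfun Xu. Qed.

Lemma integrable_scale (f : 'rV[R]_N -> R) c : mu.-integrable Omega (EFin \o f) ->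
  mu.-integrable Omega (EFin \o (fun x => c * f x)).
Proof.
move=> fi; apply: (@eq_integrable _ _ _ mu _ mO (fun x => c%:E * (f x)%:E)%E) => //.
exact: integrableZl.
Qed.

Lemma integrable_add (f g : 'rV[R]_N -> R) : mu.-integrable Omega (EFin \o f) ->
  mu.-integrable Omega (EFin \o g) ->
  mu.-integrable Omega (EFin \o (fun x => f x + g x)).
Proof. by move=> fi gi; exact: (integrableD mO fi gi). Qed.

Lemma integrable_sub (f g : 'rV[R]_N -> R) : mu.-integrable Omega (EFin \o f) ->
  mu.-integrable Omega (EFin \o g) ->
  mu.-integrable Omega (EFin \o (fun x => f x - g x)).
Proof. by move=> fi gi; exact: (integrableB mO fi gi). Qed.

Lemma Rintegral_lin2 (f g : 'rV[R]_N -> R) c e :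
  mu.-integrable Omega (EFin \o f) -> mu.-integrable Omega (EFin \o g) ->
  \int[mu]_(x in Omega) (c * f x + e * g x) =
  c * \int[mu]_(x in Omega) f x + e * \int[mu]_(x in Omega) g x.
Proof.
move=> fi gi; rewrite RintegralD//; try exact: integrable_scale.
by rewrite !RintegralZl.
Qed.

Lemma sqr_pos_part (x : R) : Num.max x 0 ^+ 2 = 2^-1 * (x * x) + 2^-1 * (x * `|x|).
Proof. by case: (lerP 0 x) => x0; [rewrite ger0_norm//|rewrite ltr0_norm//]; field. Qed.

Lemma sqr_neg_part (x : R) : Num.max (- x) 0 ^+ 2 = 2^-1 * (x * x) - 2^-1 * (x * `|x|).
Proof. by rewrite sqr_pos_part normrN; ring. Qed.

Lemma energyE u a b : X u ->
  2 * energy s Omega u a b =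
  A u u - (a + b) / 2 * B u u - (b - a) / 2 * smass u.
Proof.
move=> Xu; rewrite /energy /Xnorm sqr_sqrtr ?(ip_ge0 Xu)//.
have -> : \int[mu]_(x in Omega) (b * u^\+ x ^+ 2 + a * u^\- x ^+ 2) =
    (a + b) / 2 * B u u + (b - a) / 2 * smass u.
  rewrite -Rintegral_lin2; [|exact: mass_integrable|exact: smass_integrable].
  apply: eq_Rintegral => x _; rewrite /funrpos /funrneg sqr_pos_part sqr_neg_part.
  by field.
by field.
Qed.

(** If [smass u = 0], the squares of both parts integrate to half of [B u u]. *)
Lemma L2norm_smass u : X u ->
  L2norm Omega u^\+ != L2norm Omega u^\- -> smass u != 0.
Proof.
move=> Xu; apply: contra => /eqP u0; rewrite /L2norm; apply/eqP; congr Num.sqrt.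
transitivity (\int[mu]_(x in Omega) (2^-1 * (u x * u x) + 2^-1 * (u x * `|u x|))).
  by apply: eq_Rintegral => x _; rewrite /funrpos sqr_pos_part.
transitivity (\int[mu]_(x in Omega) (2^-1 * (u x * u x) + (- 2^-1) * (u x * `|u x|))).
  rewrite !Rintegral_lin2; try exact: mass_integrable; try exact: smass_integrable.
  by rewrite -/(smass u) u0 !mulr0.
by apply: eq_Rintegral => x _; rewrite /funrneg sqr_neg_part mulNr.
Qed.

Lemma smassZ c u : X u -> smass (c *: u) = c * `|c| * smass u.
Proof.
move=> Xu; rewrite -RintegralZl//; last exact: smass_integrable.
apply: eq_Rintegral => x _; have -> : (c *: u) x = c * u x by [].
by rewrite normrM mulrACA.
Qed.

Lemma smass_le u : X u -> `|smass u| <= B u u.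
Proof.
move=> Xu; apply: (le_trans (le_normr_Rintegral mO (smass_integrable Xu))).
rewrite le_eqVlt; apply/orP; left; apply/eqP; apply: eq_Rintegral => x _.
by rewrite normrM normr_id -normrM ger0_norm// -expr2 sqr_ge0.
Qed.

(** Pointwise, the difference of [(x + y) |x + y|] and [y |y|] is at most [x^2 + 2 |x| |y|], and the
    cross term is split by Young's inequality with weight [K]. *)
Lemma smass_perturbation K u w : 0 < K -> X u -> X w ->
  `|smass (u + w) - smass w| <= (1 + K) * B u u + K^-1 * B w w.
Proof.
move=> K0 Xu Xw; have Xuw : X (u + w) by exact: (subspaceD (Xs_sub _ _)).
rewrite -Rintegral_lin2; [|exact: mass_integrable|exact: mass_integrable].
rewrite -RintegralB//; [|exact: smass_integrable|exact: smass_integrable].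
have i0 := integrable_sub (smass_integrable Xuw) (smass_integrable Xw).
apply: (le_trans (le_normr_Rintegral mO i0)).
apply: le_Rintegral => //.
- exact: integrable_norm i0.
- by apply: integrable_add; apply: integrable_scale; exact: mass_integrable.
move=> x _; have -> : (u + w) x = u x + w x by [].
move: (u x) (w x) => {i0 Xu Xw Xuw u w}x' y.
have h1 : `|(x' + y) * `|x' + y| - y * `|y| | <= x' ^+ 2 + 2 * `|x'| * `|y|.
  have -> : (x' + y) * `|x' + y| - y * `|y| =
    x' * `|x' + y| + y * (`|x' + y| - `|y|) by ring.
  rewrite (le_trans (ler_normD _ _))// !normrM normr_id.
  have d1 := ler_wpM2l (normr_ge0 x') (ler_normD x' y).
  have := ler_dist_dist (x' + y) y; rewrite addrK => d2.
  have d3 := ler_wpM2l (normr_ge0 y) d2.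
  by rewrite -(real_normK (num_real x')) expr2; lra.
apply: (le_trans h1).
have : 0 <= K^-1 * (K * `|x'| - `|y|) ^+ 2 by rewrite mulr_ge0 ?sqr_ge0// invr_ge0 ltW.
have -> : K^-1 * (K * `|x'| - `|y|) ^+ 2 =
   K * `|x'| ^+ 2 - 2 * `|x'| * `|y| + K^-1 * `|y| ^+ 2 by field; rewrite gt_eqF.
by rewrite !real_normK ?num_real//; lra.
Qed.

(** Here [h] is a displacement of [b] off the line [a + b = 2 * l]. It contributes [h] times half of
    [B + smass] at [u + w], and [|smass| <= B]. *)
Lemma energy_near l t h K u w : 0 < K -> X u -> X w ->
  A w w = l * B w w -> A u w = 0 -> B u w = 0 ->
  `|2 * energy s Omega (u + w) (l - t) (l + t + h)
    - (A u u - l * B u u - t * smass w)| <=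
  `|t| * ((1 + K) * B u u + K^-1 * B w w) + `|h| * (B u u + B w w).
Proof.
move=> K0 Xu Xw lw Auw Buw; have sX := Xs_sub s Omega.
have Xuw : X (u + w) by exact: (subspaceD sX).
rewrite energyE// (formDD sX (ip_form s Omega))// Auw lw.
have BD : B (u + w) (u + w) = B u u + B w w.
  by rewrite (formDD sX (mass_form s mO))// Buw mulr0 addr0.
rewrite BD; set S := smass _; set S' := smass w.
rewrite [X in `|X|](_ : _ =
  - (t * (S - S') + h * (2^-1 * (B u u + B w w + S)))); last by field.
rewrite normrN (le_trans (ler_normD _ _))// !normrM lerD//.
  by rewrite ler_wpM2l//; exact: smass_perturbation.
rewrite ler_wpM2l// (ger0_norm (_ : 0 <= 2^-1))//.
have := smass_le Xuw; rewrite BD -/S ler_norml => /andP[S1 S2].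
by rewrite ger0_norm; lra.
Qed.

(** The slope of [2 * energy] in [b] is [- (B u u + smass u) / 2], and [|smass u| <= B u u]. *)
Lemma energy_antitone u a b b' : X u -> b <= b' ->
  energy s Omega u a b' <= energy s Omega u a b.
Proof.
move=> Xu bb; have := energyE a b Xu; have := energyE a b' Xu.
have := smass_le Xu; rewrite ler_norml => /andP[S1 S2].
have : 0 <= (b' - b) * (B u u + smass u) by rewrite mulr_ge0; lra.
lra.
Qed.

End energy.

(** * The curves nu_{k-1} and mu_k near the resonance point *)

Section resonance.
Context {R : realType} {N : nat}.
Variables (s : R) (Omega : set 'rV[R]_N) (lam : nat -> R) (k : nat).
Hypotheses (mO : measurable Omega) (bO : bounded_set Omega) (s_gt0 : 0 < s).
Hypothesis lamE : distinct_eigenvalues s Omega lam.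
Hypothesis k2 : (2 <= k)%N.
Local Notation mu := (@lebesgue_rV R N).
Local Notation X := (Xs s Omega).
Local Notation A := (ip s).
Local Notation B := (mass Omega).
Local Notation sX := (Xs_sub s Omega).
Local Notation Af := (ip_form s Omega).
Local Notation Bf := (mass_form s mO).

Let lam1_gt0 : 0 < lam 1%N. Proof. by case: lamE. Qed.

Let lam_incr j : (1 <= j)%N -> lam j < lam j.+1.
Proof. by case: lamE => _ + _; exact. Qed.

Let A_ge0 u : X u -> 0 <= A u u. Proof. exact: ip_ge0. Qed.
Let B_ge0 u : X u -> 0 <= B u u. Proof. exact: mass_ge0. Qed.

(** A function that is 0 almost everywhere has [B u u = 0], so [u] is a genuine eigenfunction. *)
Lemma eigenvalue_listed l u : eigset X A B l u -> B u u != 0 ->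
  exists2 j, (1 <= j)%N & l = lam j.
Proof.
move=> Eu Bu; have [_ _ /(_ l)[+ _]] := lamE; apply; exists u; split=> //.
move=> u0; move/eqP: Bu; apply; apply: EFin_inj.
rewrite (mass_sqE mO Eu.1) (ae_eq_integral (cst 0%E))//.
- exact: integral0.
- apply/measurable_EFinP/measurable_funX.
  exact: (Lfun2_measurable (Xs_Lfun Eu.1)).
- by apply: filterS u0 => x -> _; rewrite expr0n.
Qed.

Let k1 : (1 <= k)%N. Proof. exact: ltnW. Qed.
Let kp1 : (1 <= k.-1)%N. Proof. by rewrite -ltnS prednK. Qed.
Let kK : k.-1.+1 = k. Proof. by rewrite prednK. Qed.

Lemma Nsp_le v : Nsp s Omega lam k.-1 v -> A v v <= lam k.-1 * B v v.
Proof. exact: (eigsum_le sX Af Bf B_ge0 lam_incr kp1). Qed.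

Lemma Nsp_orth v y : Nsp s Omega lam k.-1 v -> eigsp s Omega lam k y ->
  A v y = 0 /\ B v y = 0.
Proof.
by apply: (eigsum_orth sX Af Bf lam_incr); rewrite prednK.
Qed.

Lemma Nsp_Xs j v : Nsp s Omega lam j v -> X v.
Proof. exact: (@eigsum_X _ _ _ sX A B). Qed.

Lemma Msp_ge w : Msp s Omega lam k w -> lam k.+1 * B w w <= A w w.
Proof.
apply: (annihilator_eigsum_ge sX Af Bf A_ge0 B_ge0 _ _ lam1_gt0 lam_incr).
- exact: Xs_complete.
- exact: Xs_compact.
- exact: eigenvalue_listed.
Qed.

Lemma Msp_orth w y : Msp s Omega lam k w -> eigsp s Omega lam k y ->
  A w y = 0 /\ B w y = 0.
Proof.
move=> Mw Ey; apply: (annihilator_eigsum_orth sX Af Bf lam1_gt0 lam_incr Mw).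
by apply: (eigset_eigsum sX Af Bf _ Ey); rewrite k1 leqnn.
Qed.

Lemma lamk_gt0 : 0 < lam k.
Proof. exact: (lam_gt0 lam1_gt0 lam_incr). Qed.

Lemma lamk_pred : lam k.-1 < lam k.
Proof. by rewrite -{2}kK; exact: lam_incr. Qed.

Lemma lamk_succ : lam k < lam k.+1.
Proof. exact: lam_incr. Qed.

Lemma eigsp_scale c y : eigsp s Omega lam k y -> eigsp s Omega lam k (c *: y).
Proof. by apply: subspaceZ; exact: (eigset_sub sX Af Bf). Qed.

(** Scaling by [c] multiplies [smass] by [c |c|], so the sign of the normalising factor makes it
    positive. *)
Lemma normalized_eigenfunction y : eigsp s Omega lam k y -> smass Omega y != 0 ->
  exists z, [/\ eigsp s Omega lam k z, A z z = 1 & 0 < smass Omega z].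
Proof.
move=> Ey y0; have Xy : X y := Ey.1.
have By : 0 < B y y.
  by apply: lt_le_trans (smass_le mO Xy); rewrite normr_gt0.
have Ay : 0 < A y y by rewrite Ey.2// mulr_gt0// lamk_gt0.
have r0 : 0 < (Num.sqrt (A y y))^-1 by rewrite invr_gt0 sqrtr_gt0.
have rA : (Num.sqrt (A y y))^-1 ^+ 2 * A y y = 1.
  by rewrite exprVn sqr_sqrtr ?(ltW Ay)// mulVf// gt_eqF.
set r := _^-1 in r0 rA.
have [sy|sy] := ltP 0 (smass Omega y).
  exists (r *: y); split; first exact: eigsp_scale.
    by rewrite (formZZ sX Af).
  by rewrite (smassZ mO _ Xy) gtr0_norm// mulr_gt0// mulr_gt0.
exists ((- r) *: y); split; first exact: eigsp_scale.
  by rewrite (formZZ sX Af)// sqrrN.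
rewrite (smassZ mO _ Xy) normrN gtr0_norm// !mulNr -mulrN mulr_gt0 ?mulr_gt0//.
by rewrite oppr_gt0 lt_neqAle y0.
Qed.

Variable y : 'rV[R]_N -> R.
Hypotheses (Ey : eigsp s Omega lam k y) (Ay : A y y = 1) (Fy : 0 < smass Omega y).

Let Xy : X y. Proof. by case: Ey. Qed.

Let By : 0 < B y y.
Proof.
by apply: lt_le_trans (smass_le mO Xy); rewrite normr_gt0 gt_eqF.
Qed.

Let gap := Num.min (lam k - lam k.-1) (lam k.+1 - lam k).
(** With this weight, the error term [K^-1 * B y y] is a quarter of [smass Omega y]. *)
Let K := 4 * B y y / smass Omega y.
(** For [|t| < radius] the error [|t| * (1 + K) * B u u] is at most half of [gap * B u u]. *)
Let radius := gap / (2 * (1 + K)).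

Let K_gt0 : 0 < K.
Proof. by rewrite divr_gt0// mulr_gt0. Qed.

Let gap_gt0 : 0 < gap.
Proof. by rewrite lt_min !subr_gt0 lamk_pred lamk_succ. Qed.

Let gap_pred : gap <= lam k - lam k.-1.
Proof. by rewrite ge_min lexx. Qed.

Let gap_succ : gap <= lam k.+1 - lam k.
Proof. by rewrite ge_min lexx orbT. Qed.

Let radius_gt0 : 0 < radius.
Proof. by rewrite divr_gt0// mulr_gt0// addr_gt0. Qed.

Let radiusE : radius * (1 + K) = gap / 2.
Proof. by rewrite /radius; field; rewrite gt_eqF// addr_gt0. Qed.

Let radius_le : radius <= gap.
Proof. have := radiusE; have := K_gt0; have := radius_gt0; nra. Qed.

Lemma eigsp_sign (t : R) : t != 0 -> exists w,
  [/\ eigsp s Omega lam k w, A w w = 1, B w w = B y y &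
      t * smass Omega w = `|t| * smass Omega y].
Proof.
rewrite neq_lt => /orP[t0|t0]; last by exists y; rewrite gtr0_norm.
exists (-1 *: y); split; first exact: eigsp_scale.
- by rewrite (formZZ sX Af)// sqrrN expr1n mul1r.
- by rewrite (formZZ sX Bf)// sqrrN expr1n mul1r.
by rewrite (smassZ mO _ Xy) normrN normr1 ltr0_norm//; ring.
Qed.

(* The quadratic form [A - lam k B] is coercive on both sides of the resonance
   eigenspace, which absorbs the perturbation of [smass] caused by [u]. *)
Lemma energy_bound t h u w : `|t| < radius -> X u ->
  eigsp s Omega lam k w -> B w w = B y y -> A u w = 0 -> B u w = 0 ->
  h = Num.min (gap / 2) (`|t| * smass Omega y / (4 * B y y)) \/
  h = - Num.min (gap / 2) (`|t| * smass Omega y / (4 * B y y)) ->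
  `|2 * energy s Omega (u + w) (lam k - t) (lam k + t + h)
    - (A u u - lam k * B u u - t * smass Omega w)| <=
  gap * B u u + `|t| * smass Omega y / 2.
Proof.
move=> tr Xu Ew Bw Auw Buw hE; have Xw : X w by case: Ew.
have lw : A w w = lam k * B w w by exact: Ew.2.
apply: le_trans (@energy_near _ _ _ _ mO (lam k) t h K u w K_gt0 Xu Xw lw Auw Buw) _.
rewrite Bw; have Bu := B_ge0 Xu.
have K1 : K^-1 * B y y = smass Omega y / 4.
  by rewrite /K; field; rewrite !gt_eqF.
rewrite K1.
have t1 : `|t| * ((1 + K) * B u u) <= gap / 2 * B u u.
  by rewrite mulrA ler_wpM2r// -radiusE ler_wpM2r ?ltW// addr_gt0.
(* The first entry keeps [e * B u u] within the other half of [gap * B u u]; the second keeps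
   [e * B y y] within a quarter of [|t| * smass Omega y]. *)
set e := Num.min _ _ in hE.
have e0 : 0 <= e.
  rewrite le_min divr_ge0 ?(ltW gap_gt0)//= divr_ge0 ?mulr_ge0// ltW//.
have -> : `|h| = e by case: hE => ->; rewrite ?normrN ger0_norm.
have e1 : e * B u u <= gap / 2 * B u u by rewrite ler_wpM2r// ge_min lexx.
have e2 : e * B y y <= `|t| * smass Omega y / 4.
  have : e <= `|t| * smass Omega y / (4 * B y y) by rewrite ge_min lexx orbT.
  rewrite -(ler_pM2r By) => /le_trans; apply; rewrite le_eqVlt.
  by apply/orP; left; apply/eqP; field; rewrite gt_eqF.
lra.
Qed.

(** Every [b > lam k + t - e] has [n_pred] negative, tested with [w = y] or [-y] such that
    [t * smass w > 0]. The margin [e] makes the inequality for the supremum strict. *)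
Lemma nu_pred_lt t : t != 0 -> `|t| < radius ->
  (nu_pred s Omega lam k (lam k - t) < (lam k + t)%:E)%E.
Proof.
move=> t0 tr; have [w [Ew Aw Bw Fw]] := eigsp_sign t0.
have Xw : X w by case: Ew.
set e := Num.min (gap / 2) (`|t| * smass Omega y / (4 * B y y)).
have tF : 0 < `|t| * smass Omega y by rewrite mulr_gt0// normr_gt0.
have e0 : 0 < e by rewrite lt_min !divr_gt0// mulr_gt0.
apply: (@le_lt_trans _ _ (lam k + t - e)%:E); last by rewrite lte_fin ltrBlDr ltrDl.
apply: ge_ereal_sup => _ [b [_ nb] <-]; rewrite lee_fin leNgt.
apply/negP => eb; move: nb; apply/negP; rewrite -ltNge.
apply: (@le_lt_trans _ _ (- (`|t| * smass Omega y / 4))%:E); last first.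
  by rewrite lte_fin oppr_lt0 divr_gt0.
apply: ge_ereal_inf; eexists.
  exists w; last by reflexivity.
  split; last by rewrite /Xnorm Aw sqrtr1.
  split=> // v Nv; rewrite (formC Af); exact: (Nsp_orth Nv Ew).1.
apply: ge_ereal_sup => _ [v Nv <-]; rewrite lee_fin.
have Xv := Nsp_Xs Nv; have [Avw Bvw] := Nsp_orth Nv Ew.
have Xvw : X (v + w) by exact: (subspaceD sX).
apply: le_trans (energy_antitone mO (lam k - t) Xvw (ltW eb)) _.
(* On [Nsp] the form [A - lam k * B] is at most [- gap * B], which cancels the error [gap * B v v];
   half of the term [- |t| * smass Omega y] survives. *)
have := @energy_bound t (- e) v w tr Xv Ew Bw Avw Bvw (or_intror erefl).
rewrite ler_norml Fw => /andP[_].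
have := Nsp_le Nv; have := ler_wpM2r (B_ge0 Xv) gap_pred.
lra.
Qed.

(** The mirror argument: [w] has the opposite sign, [A - lam k * B] is at least [gap * B] on [Msp],
    and so [m_] is positive for every [b < lam k + t + e]. *)
Lemma mu_gt t : t != 0 -> `|t| < radius ->
  ((lam k + t)%:E < mu_ s Omega lam k (lam k - t))%E.
Proof.
move=> t0 tr; have nt0 : - t != 0 by rewrite oppr_eq0.
have [w [Ew Aw Bw Fw]] := eigsp_sign nt0; rewrite normrN mulNr in Fw.
have Xw : X w by case: Ew.
set e := Num.min (gap / 2) (`|t| * smass Omega y / (4 * B y y)).
have tF : 0 < `|t| * smass Omega y by rewrite mulr_gt0// normr_gt0.
have e0 : 0 < e by rewrite lt_min !divr_gt0// mulr_gt0.
apply: (@lt_le_trans _ _ (lam k + t + e)%:E); first by rewrite lte_fin ltrDl.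
apply: le_ereal_inf_tmp => _ [b [_ mb] <-]; rewrite lee_fin leNgt.
apply/negP => eb; move: mb; apply/negP; rewrite -ltNge.
apply: (@lt_le_trans _ _ (`|t| * smass Omega y / 4)%:E).
  by rewrite lte_fin divr_gt0.
apply: le_ereal_sup_tmp; eexists.
  exists w; last by reflexivity.
  split; last by rewrite /Xnorm Aw sqrtr1.
  by apply: (eigset_eigsum sX Af Bf _ Ew); rewrite k1 leqnn.
apply: le_ereal_inf_tmp => _ [z Mz <-]; rewrite lee_fin.
have Xz : X z by case: Mz.
have [Azw Bzw] := Msp_orth Mz Ew.
have -> : w \+ z = z + w by apply/funext => x; rewrite /= addrC.
have Xzw : X (z + w) by exact: (subspaceD sX).
apply: le_trans (energy_antitone mO (lam k - t) Xzw (ltW eb)).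
have := @energy_bound t e z w tr Xz Ew Bw Azw Bzw (or_introl erefl).
rewrite ler_norml => /andP[+ _].
have := Msp_ge Mz; have := ler_wpM2r (B_ge0 Xz) gap_succ.
lra.
Qed.

Lemma region_II_near : exists2 U : set (R * R),
  nbhs (lam k, lam k) U /\ U `<=` Qsq lam k &
  forall a b : R, U (a, b) -> (a, b) <> (lam k, lam k) ->
    a + b = 2 * lam k -> region_II s Omega lam k (a, b).
Proof.
(* As [radius <= gap], this open square stays between the neighbouring eigenvalues. *)
exists [set ab | `|ab.1 - lam k| < radius /\ `|ab.2 - lam k| < radius]; first split.
- exists (ball (lam k) radius, ball (lam k) radius).
    by split; exact: nbhsx_ballx.
  by move=> [a b] [/= ha hb]; split; rewrite distrC.
- move=> [a b] [/= ha hb]; move: ha hb; rewrite !ltr_distl.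
  have := radius_le; have := gap_pred; have := gap_succ.
  move=> h1 h2 h3 /andP[? ?] /andP[? ?].
  by split; apply/andP; split=> /=; lra.
move=> a b [/= ha hb] ab abE; set t := b - lam k.
have aE : a = lam k - t by rewrite /t; lra.
have bE : b = lam k + t by rewrite /t; lra.
have t0 : t != 0.
  by apply/eqP => t0; apply: ab; rewrite aE bE t0 subr0 addr0.
split.
  move: ha hb; rewrite !ltr_distl.
  have := radius_le; have := gap_pred; have := gap_succ.
  move=> h1 h2 h3 /andP[? ?] /andP[? ?].
  by split; apply/andP; split=> /=; lra.
by rewrite /= aE bE nu_pred_lt// mu_gt.
Qed.

End resonance.

Theorem theorem3p7 (R : realType) (N : nat) (s : R) (Omega : set 'rV[R]_N)
    (lam : nat -> R) (k : nat) :
  0 < s < 1 -> 2 * s < N%:R ->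
  bounded_lipschitz_domain Omega ->
  distinct_eigenvalues s Omega lam ->
  (2 <= k)%N ->
  (exists2 y, eigsp s Omega lam k y & L2norm Omega y^\+ != L2norm Omega y^\-) ->
  exists2 U : set (R * R), nbhs (lam k, lam k) U /\ U `<=` Qsq lam k &
    forall a b : R, U (a, b) -> (a, b) <> (lam k, lam k) ->
      a + b = 2 * lam k -> region_II s Omega lam k (a, b).
Proof.
move=> /andP[s0 _] _ [oO _ _ bO _] lamE k2 [y0 Ey0 yne].
have mO := open_measurable_rV oO.
have Fy0 := L2norm_smass mO Ey0.1 yne.
have [y [Ey Ay Fy]] := normalized_eigenfunction mO lamE k2 Ey0 Fy0.
exact: (region_II_near mO bO s0 lamE k2 Ey Ay Fy).
Qed.
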